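(* Let $k$ and $\lambda$ be fixed positive integers with $k\geq\lambda+2$. Then there exists an integer $v_0$ such that for every cyclic $(v,k,\lambda)$-BIBD with $v\geq v_0$, it is possible to choose one block from each block orbit so that the chosen blocks are pairwise disjoint.
   Context: A $(v,k,\lambda)$-BIBD is a pair $(X,\mathcal{B})$ with $|X|=v$ and $\mathcal{B}$ a (multi)set of $k$-subsets of $X$ (blocks) such that every pair of distinct points lies in exactly $\lambda$ blocks. It is cyclic if it admits an automorphism (a permutation of $X$ mapping $\mathcal{B}$ onto itself as a multiset) that is a single cycle of length $v$; identifying $X$ with $\mathbb{Z}_v$ so that this automorphism is $x\mapsto x+1$, the block orbit of a block $B$ is the set of distinct blocks $B+i=\{b+i\mid b\in B\}$, $i\in\mathbb{Z}_v$. The blocks of $\mathcal{B}$ are partitioned into block orbits (counted with multiplicity, so repeated orbits are distinct orbits), and one block is to be chosen from each orbit. *)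

(* Defs.v *)
From mathcomp Require Import all_boot all_fingroup.

Set Implicit Arguments.
Unset Strict Implicit.
Unset Printing Implicit Defensive.

(* A multiset of blocks is a sequence considered up to perm_eq: every notion
   below depends on Bs only through the multiplicities count_mem b Bs. *)
Definition is_BIBD (v k lambda : nat) (X : finType) (Bs : seq {set X}) : Prop :=
  [/\ #|X| = v,
      forall b, b \in Bs -> #|b| = k
    & forall x y : X, x != y ->
        count (fun b : {set X} => (x \in b) && (y \in b)) Bs = lambda].

Definition is_automorphism (X : finType) (Bs : seq {set X}) (sigma : {perm X}) :
    Prop :=
  perm_eq [seq sigma @: b | b : {set X} <- Bs] Bs.

Definition full_cycle (X : finType) (sigma : {perm X}) : Prop :=
  porbits sigma = [set [set: X]].

Definition cyclic_BIBD (v k lambda : nat) (X : finType) (Bs : seq {set X})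
    (sigma : {perm X}) : Prop :=
  [/\ is_BIBD v k lambda Bs, is_automorphism Bs sigma & full_cycle sigma].

(* Under the identification of X with Z_v that turns sigma into x |-> x + 1,
   this is the set of the translates b + i. *)
Definition block_orbit (X : finType) (sigma : {perm X}) (b : {set X}) :
    {set {set X}} :=
  orbit ('P^*)%act <[sigma]>%g b.

(* The block orbits counted with multiplicity: (O, j) is the j-th copy of O.
   When sigma is an automorphism, the multiplicity count_mem b Bs is the same
   for all b in O, so that O has exactly that many copies. *)
Definition is_block_orbit (X : finType) (Bs : seq {set X}) (sigma : {perm X})
    (o : {set {set X}} * nat) : Prop :=
  exists b : {set X}, o.1 = block_orbit sigma b /\ o.2 < count_mem b Bs.

Definition disjoint_representatives (X : finType) (Bs : seq {set X})
    (sigma : {perm X}) (c : {set {set X}} * nat -> {set X}) : Prop :=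
  (forall o, is_block_orbit Bs sigma o -> c o \in o.1) /\
  (forall o o', is_block_orbit Bs sigma o -> is_block_orbit Bs sigma o' ->
     o <> o' -> [disjoint c o & c o']).

(* Main.v *)
Require Import Defs.
From mathcomp Require Import all_boot all_fingroup all_order all_algebra.
From mathcomp Require Import ring lra zify.

Set Implicit Arguments.
Unset Strict Implicit.
Unset Printing Implicit Defensive.

Import Order.TTheory GRing.Theory Num.Theory.

(* Fix a representative of each of the m block orbits; a choice of blocks is a
   matching, covering all orbits, of the hypergraph on points and orbits whose
   edges are the translates of the representatives, each together with its
   orbit.  Run the random greedy process that picks a random edge at each step
   and keeps it if it meets no kept edge.  The probabilities u_t(W) that a set
   W of vertices is still uncovered satisfy the exact linear hierarchy
     u_(t+1)(W) = u_t(W) - (1/D) sum_(e meets W) u_t(W :|: e).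
   As codegrees are bounded, the product of the one-vertex solutions of the
   mean field recursion almost solves this hierarchy, and u_t(W) stays close to
   it for a time proportional to v.  Since k m <= (1 - c) v (here
   lambda <= k - 2 is used), the density of the uncovered points never falls
   below c, so the density of the uncovered orbits tends to 0; by a second
   moment computation almost every orbit has a positive proportion of its
   translates uncovered.  The few exceptional orbits are placed first, and the
   orbits left over are then placed greedily. *)

(** * Random greedy matchings and their mean field approximation *)

Section RandomGreedy.
Local Open Scope ring_scope.

Variables (R : realFieldType) (V E : finType) (ed : E -> {set V}) (D : R).

Definition cov (M : {set E}) : {set V} := \bigcup_(e in M) ed e.

Definition step (M : {set E}) (e : E) : {set E} :=
  if [disjoint ed e & cov M] then e |: M else M.

(* Expectation after one step, in which each edge is picked with probability
   [1 / D], and nothing is picked with the remaining probability. *)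
Definition avg (phi : {set E} -> R) (M : {set E}) : R :=
  phi M + D^-1 * \sum_e (phi (step M e) - phi M).

Definition expect (t : nat) (phi : {set E} -> R) : R := iter t avg phi set0.

Definition unc (W : {set V}) (M : {set E}) : R := [disjoint W & cov M]%:R.

(* Evolution of the probability that [w] is uncovered, if the events that
   different vertices are uncovered were independent. *)
Fixpoint mf (t : nat) (w : V) : R :=
  if t is t'.+1 then
    mf t' w - D^-1 * \sum_(e | w \in ed e) \prod_(z in ed e) mf t' z
  else 1.

Definition matching (M : {set E}) : Prop :=
  forall e e', e \in M -> e' \in M -> e != e' -> [disjoint ed e & ed e'].

Lemma covU1 e M : cov (e |: M) = ed e :|: cov M.
Proof. by rewrite /cov bigcup_setU big_set1. Qed.

Lemma matching_step M e : matching M -> matching (step M e).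
Proof.
rewrite /step; case: ifP => // dis mM.
have H e' : e' \in M -> [disjoint ed e & ed e'].
  by move=> e'M; apply: disjointWr dis; rewrite /cov (bigcup_sup e').
move=> e1 e2; rewrite !inE.
case/orP=> [/eqP->|h1]; case/orP=> [/eqP->|h2] ne.
- by rewrite eqxx in ne.
- exact: H.
- by rewrite disjoint_sym; apply: H.
- exact: mM.
Qed.

(** * Linearity of the expectation *)

Lemma eq_iter_avg t phi psi :
  phi =1 psi -> iter t avg phi =1 iter t avg psi.
Proof.
elim: t => //= t IH e M; rewrite /avg (IH e M); congr (_ + _ * _).
by apply: eq_bigr => e' _; rewrite !(IH e).
Qed.

Lemma eq_expect t phi psi : phi =1 psi -> expect t phi = expect t psi.
Proof. by move=> e; apply: eq_iter_avg. Qed.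

Lemma iter_avgD t phi psi M :
  iter t avg (fun N => phi N + psi N) M = iter t avg phi M + iter t avg psi M.
Proof.
elim: t M => //= t IH M; rewrite /avg IH.
under eq_bigr do rewrite !IH opprD addrACA.
by rewrite big_split /= mulrDr addrACA.
Qed.

Lemma iter_avgZ t a phi M :
  iter t avg (fun N => a * phi N) M = a * iter t avg phi M.
Proof.
elim: t M => //= t IH M; rewrite /avg IH.
under eq_bigr do rewrite !IH -mulrBr.
by rewrite -mulr_sumr mulrCA -mulrDr.
Qed.

Lemma iter_avg_cst t a M : iter t avg (fun=> a) M = a.
Proof.
elim: t M => //= t IH M; rewrite /avg IH.
under eq_bigr do rewrite !IH subrr.
by rewrite big1_eq mulr0 addr0.
Qed.

Lemma expectD t phi psi :
  expect t (fun M => phi M + psi M) = expect t phi + expect t psi.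
Proof. exact: iter_avgD. Qed.

Lemma expectZ t a phi : expect t (fun M => a * phi M) = a * expect t phi.
Proof. exact: iter_avgZ. Qed.

Lemma expect_cst t a : expect t (fun=> a) = a.
Proof. exact: iter_avg_cst. Qed.

Lemma expect_sum t (J : Type) (s : seq J) (P : pred J) (F : J -> {set E} -> R) :
  expect t (fun M => \sum_(j <- s | P j) F j M) =
  \sum_(j <- s | P j) expect t (F j).
Proof.
elim: s => [|j s IH].
  rewrite big_nil -[RHS](expect_cst t); apply: eq_expect => M.
  by rewrite big_nil.
rewrite big_cons -IH; case Pj : (P j); last first.
  by apply: eq_expect => M; rewrite big_cons Pj.
by rewrite -expectD; apply: eq_expect => M; rewrite big_cons Pj.
Qed.

(** * The linear hierarchy for uncovered sets *)

Lemma disjointsU (A B C : {set V}) :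
  [disjoint A :|: B & C] = [disjoint A & C] && [disjoint B & C].
Proof. by rewrite -!setI_eq0 setIUl setU_eq0. Qed.

Lemma uncU W W' M : unc (W :|: W') M = unc W M * unc W' M.
Proof. by rewrite /unc disjointsU -natrM mulnb. Qed.

(** A picked edge changes the status of [W] only if it meets [W] and is kept; then both were
    uncovered before, which is one condition on their union. *)
Lemma unc_step W M e :
  unc W (step M e) - unc W M =
  - (if [disjoint ed e & W] then 0 else unc (W :|: ed e) M).
Proof.
rewrite /step uncU /unc; case dM: [disjoint ed e & cov M]; last first.
  by rewrite mulr0 subrr if_same oppr0.
rewrite covU1 ![[disjoint W & _]]disjoint_sym disjointsU mulr1.
by case: [disjoint ed e & W] => /=; rewrite ?subrr ?oppr0 ?sub0r.
Qed.

Lemma avg_unc W M :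
  avg (unc W) M =
  unc W M - D^-1 * \sum_(e | ~~ [disjoint ed e & W]) unc (W :|: ed e) M.
Proof.
rewrite /avg -mulrN; congr (_ + _ * _).
rewrite -sumrN [RHS]big_mkcond /=; apply: eq_bigr => e _.
by rewrite unc_step; case: ifP => /=; rewrite ?oppr0.
Qed.

Local Notation u t W := (expect t (unc W)).

Lemma u_recr t W :
  u t.+1 W = u t W - D^-1 * \sum_(e | ~~ [disjoint ed e & W]) u t (W :|: ed e).
Proof.
rewrite /= -expect_sum -expectZ -mulN1r -expectZ -expectD.
(* The innermost average is the last step of the process, to which the one-step identity applies. *)
rewrite /expect iterSr; apply: eq_iter_avg => M.
by rewrite avg_unc mulN1r.
Qed.

(** * Positivity and the first moment method *)

Hypothesis D_gt : (#|E|%:R < D)%R.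

Let D_gt0 : 0 < D.
Proof. exact: le_lt_trans (ler0n _ _) D_gt. Qed.

Lemma avgE phi M :
  avg phi M = (1 - #|E|%:R / D) * phi M + D^-1 * \sum_e phi (step M e).
Proof.
rewrite /avg sumrB sumr_const -mulr_natl cardT -cardE.
by ring.
Qed.

Let lazy_gt0 : 0 < 1 - #|E|%:R / D.
Proof. by rewrite subr_gt0 ltr_pdivrMr // mul1r. Qed.

Lemma expect_ge0 t phi : (forall M, 0 <= phi M) -> 0 <= expect t phi.
Proof.
move=> phi0; rewrite /expect; move: set0.
elim: t => //= t IH M; rewrite avgE.
apply: addr_ge0; first by apply: mulr_ge0 => //; apply: ltW.
by apply: mulr_ge0; [rewrite invr_ge0 ltW | apply: sumr_ge0].
Qed.

(** Picking nothing has positive probability, so strictness survives each average, and the process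
    never leaves the matchings. *)
Lemma iter_avg_gt t phi y M : matching M ->
  (forall N, matching N -> y < phi N) -> y < iter t avg phi M.
Proof.
move=> mM H; elim: t M mM => [|t IH] M mM /=; first exact: H.
rewrite avgE -subr_gt0.
have -> : (1 - #|E|%:R / D) * iter t avg phi M
          + D^-1 * (\sum_e iter t avg phi (step M e)) - y =
   (1 - #|E|%:R / D) * (iter t avg phi M - y)
   + D^-1 * (\sum_e (iter t avg phi (step M e) - y)).
  by rewrite sumrB sumr_const -mulr_natl cardT -cardE; ring.
apply: ltr_wpDr.
  apply: mulr_ge0; first by rewrite invr_ge0 ltW.
  apply: sumr_ge0 => e _; rewrite subr_ge0 ltW //.
  by apply/IH/matching_step.
by apply: mulr_gt0 => //; rewrite subr_gt0 IH.
Qed.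

Lemma matching_set0 : matching set0.
Proof. by move=> e e'; rewrite inE. Qed.

Lemma matching_le_expect t phi y : expect t phi <= y ->
  exists2 M, matching M & phi M <= y.
Proof.
move=> le_y.
(* A boolean form of [matching] makes the search over the finitely many sets decidable. *)
pose mb (M : {set E}) := [forall e, forall e', (e \in M) ==> (e' \in M) ==> (e
  != e')
  ==> [disjoint ed e & ed e']].
have mbP M : reflect (matching M) (mb M).
  apply: (iffP forallP) => [H e e' h1 h2 ne|H e].
    by have /forallP/(_ e')/implyP/(_ h1)/implyP/(_ h2)/implyP/(_ ne) := H e.
  by apply/forallP => e'; do 3!apply/implyP => ?; apply: H.
have [/existsP[M /andP[/mbP mM h]]|/existsPn H] :=
  boolP [exists M, mb M && (phi M <= y)]; first by exists M.
suff : y < y by rewrite ltxx.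
apply: lt_le_trans le_y; apply: iter_avg_gt; first exact: matching_set0.
by move=> N /mbP mN; have := H N; rewrite mN /= -ltNge.
Qed.

Lemma u_ge0 t W : 0 <= u t W.
Proof. by apply: expect_ge0 => M; rewrite ler0n. Qed.

Lemma u_le1 t W : u t W <= 1.
Proof.
rewrite /= -subr_ge0 -mulN1r -expectZ -{1}(expect_cst t 1) -expectD.
by apply: expect_ge0 => M; rewrite mulN1r subr_ge0 lern1 leq_b1.
Qed.

Section MeanField.
(** [h] bounds the probability that the edge picked at one step contains a given vertex, and
    [h * kappa] the probability that it contains two given ones. *)
Variables (k : nat) (h kappa : R).
Hypothesis ed_size : forall e, #|ed e| = k.+1.
Hypothesis h_ge0 : 0 <= h.
Hypothesis kappa_ge0 : 0 <= kappa.
Hypothesis h_le1 : h <= 1.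
Hypothesis deg_le : forall w, #|[set e | w \in ed e]|%:R <= h * D.
Hypothesis codeg_le : forall w w', w != w' ->
  #|[set e | (w \in ed e) && (w' \in ed e)]|%:R <= h * kappa * D.

Local Notation Y t W := (\prod_(w in W) mf t w).

Definition mf_loss t w : R :=
  D^-1 * \sum_(e | w \in ed e) \prod_(z in ed e) mf t z.

Lemma mfS t w : mf t.+1 w = mf t w - mf_loss t w.
Proof. by []. Qed.

Lemma prod_le1 (P : pred V) (F : V -> R) :
  (forall w, 0 <= F w <= 1) -> 0 <= \prod_(w | P w) F w <= 1.
Proof.
move=> F01; apply/andP; split; last by apply: prodr_ile1 => w _.
by apply: prodr_ge0 => w _; case/andP: (F01 w).
Qed.

(** Each product is at most its factor at [w]. The bound is relative to [mf t w], so that one step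
    cannot make the value negative. *)
Lemma mf_loss_le t w : (forall z, 0 <= mf t z <= 1) ->
  0 <= mf_loss t w <= h * mf t w.
Proof.
move=> H; rewrite /mf_loss; apply/andP; split.
  apply: mulr_ge0; first by rewrite invr_ge0 ltW.
  by apply: sumr_ge0 => e _; case/andP: (prod_le1 (mem (ed e)) H).
rewrite mulrC ler_pdivrMr // mulrAC.
apply: le_trans (_ : \sum_(e | w \in ed e) mf t w <= _).
  apply: ler_sum => e we; rewrite (bigD1 w) //=.
  case/andP: (H w) => w0 _; rewrite ler_piMr //.
  by case/andP: (prod_le1 [pred z | (z \in ed e) && (z != w)] H).
rewrite sumr_const -mulr_natl; case/andP: (H w) => w0 _.
apply: ler_wpM2r => //; apply: le_trans (deg_le w).
by rewrite ler_nat cardsE.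
Qed.

Lemma mf01 t w : 0 <= mf t w <= 1.
Proof.
elim: t w => [|t IH] w; first by rewrite /= ler01 lexx.
have /andP[l0 l1] := mf_loss_le w IH; have /andP[m0 m1] := IH w.
rewrite mfS; apply/andP; split; last by lra.
rewrite subr_ge0; apply: le_trans l1 _.
by rewrite ler_piMl.
Qed.

Lemma Y01 t (P : pred V) : 0 <= \prod_(w | P w) mf t w <= 1.
Proof. exact/prod_le1/mf01. Qed.

(** First order expansion of the product, by removing one vertex at a time. *)
Lemma prod_sub_linear (W : {set V}) (y d : V -> R) :
  (forall w, 0 <= y w <= 1) -> (forall w, 0 <= d w <= h) ->
  (forall w, 0 <= y w - d w) ->
  `|\prod_(w in W) (y w - d w) -
    (\prod_(w in W) y w - \sum_(w in W) d w * \prod_(z in W :\ w) y z)|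
  <= #|W|%:R ^+ 2 * h ^+ 2.
Proof.
move=> y01 dh yd; elim: {W}#|W| {-2}W (erefl #|W|) => [|n IH] W Wn.
  by move/cards0_eq: Wn => ->;
    rewrite !big_set0 subr0 subrr normr0 mulr_ge0 ?exprn_ge0.
have [w wW] : exists w, w \in W by apply/card_gt0P; rewrite Wn.
have Wn' : #|W :\ w| = n by have := cardsD1 w W; rewrite wW Wn => -[].
have := IH _ Wn'; rewrite !(big_setD1 w wW) /=.
set P1 := \prod_(_ in _) (_ - _); set P := \prod_(_ in _) _.
set S := \sum_(_ in _) _; set S' := \sum_(_ in _) _.
have -> : S' = y w * S.
  rewrite mulr_sumr; apply: eq_bigr => z; rewrite !inE => /andP[zw zW].
  rewrite (big_setD1 w) ?inE ?wW 1?eq_sym ?zw //= mulrCA.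
  congr (_ * (_ * _)); apply: eq_bigl => z'; rewrite !inE.
  by rewrite andbCA.
have S0 : 0 <= S <= n%:R * h.
  have T z : 0 <= \prod_(z' in (W :\ w) :\ z) y z' <= 1 by exact: prod_le1.
  apply/andP; split.
    apply: sumr_ge0 => z _; apply: mulr_ge0; first by case/andP: (dh z).
    by case/andP: (T z).
  rewrite -Wn' mulr_natl -sumr_const; apply: ler_sum => z _.
  have /andP[d0 d1] := dh z; have /andP[t0 t1] := T z.
  by apply: le_trans d1; rewrite ler_piMr.
(* The old error is multiplied by a factor at most 1, and [d w * S] adds at most [n%:R * h ^+ 2];
   finally [n ^ 2 + n <= (n + 1) ^ 2]. *)
have -> : (y w - d w) * P1 - (y w * P - (d w * P + y w * S)) =
  (y w - d w) * (P1 - (P - S)) + d w * S by ring.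
move=> H; rewrite Wn; rewrite Wn' in H.
apply: le_trans (ler_normD _ _) _; rewrite !normrM.
have /andP[S1 S2] := S0; have /andP[d0 d1] := dh w; have /andP[y0 y1] := y01 w.
rewrite (ger0_norm S1) (ger0_norm d0) (ger0_norm (yd w)).
apply: le_trans (_ : n%:R ^+ 2 * h ^+ 2 + h * (n%:R * h) <= _).
  apply: lerD; last exact: ler_pM.
  by apply: le_trans H; rewrite ler_piMl //; lra.
rewrite -natr1; have : 0 <= n%:R :> R by [].
have : 0 <= h ^+ 2 by apply: exprn_ge0.
by rewrite !expr2; nra.
Qed.

(** For edges meeting [W] in a single vertex, the linearised mean field loss has exactly the form of
    the corresponding term of the hierarchy. *)
Lemma Y_setU t (W : {set V}) e w : W :&: ed e = [set w] ->
  Y t (ed e) * Y t (W :\ w) = Y t (W :|: ed e).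
Proof.
move=> We; rewrite /= -bigU /=; last first.
  rewrite -setI_eq0 -subset0; apply/subsetP => z; rewrite !inE.
  case/and3P=> ze zw zW; have : z \in W :&: ed e by rewrite inE zW.
  by rewrite We inE (negPf zw).
apply: eq_bigl => z; rewrite !inE orbC.
have [->|] := eqVneq z w => //=.
have : w \in W :&: ed e by rewrite We set11.
by rewrite inE => /andP[-> ->].
Qed.

(* The vertices of every set [W] are uncovered independently of each other, up
   to an error exponential in the size of [W]. *)
Definition factor_error (eta x : R) t : Prop :=
  forall W, `|u t W - Y t W| <= eta * x ^+ #|W|.

(** If [e] meets [W] once, the assumed error applies to the union, of size [#|W| + k]. If it meets
    [W] in [c >= 2] vertices, the trivial bound [c] is at most [c * (c - 1)]; such edges are rare by
    the codegree bound. *)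
Lemma edge_error eta x t W e (c : R) : 0 <= eta -> 0 <= x ->
  factor_error eta x t -> c = #|W :&: ed e|%:R ->
  `|(if [disjoint ed e & W] then 0 else u t (W :|: ed e)) -
    \sum_(w in W | w \in ed e) Y t (ed e) * Y t (W :\ w)|
  <= c * (eta * x ^+ (#|W| + k)) + c * (c - 1).
Proof.
move=> eta0 x0 err ->.
have -> : \sum_(w in W | w \in ed e) Y t (ed e) * Y t (W :\ w) =
  \sum_(w in W :&: ed e) Y t (ed e) * Y t (W :\ w).
  by apply: eq_bigl => w; rewrite inE.
rewrite disjoint_sym -setI_eq0 -cards_eq0.
case E1: #|W :&: ed e| => [|[|n]] /=.
- rewrite (cards0_eq E1) big_set0 subrr normr0 !mul0r addr0 //.
- have /cards1P[w We] : #|W :&: ed e| == 1%N by rewrite E1.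
  rewrite We big_set1 (Y_setU _ We) subrr mulr0 addr0 mul1r.
  have -> : (#|W| + k)%N = #|W :|: ed e|.
    by rewrite cardsU E1 ed_size addnS subn1.
  exact: err.
- set b := \sum_(_ in _) _; set a := expect _ _.
  have : 0 <= b <= n.+2%:R.
    have T w : 0 <= Y t (ed e) * Y t (W :\ w) <= 1.
      have /andP[p1 p2] := Y01 t (mem (ed e)).
      have /andP[q1 q2] := Y01 t (mem (W :\ w)).
      by rewrite mulr_ge0 //= mulr_ile1.
    rewrite sumr_ge0 => [|w _]; last by case/andP: (T w).
    rewrite /b -E1 -sumr_const /=; apply: ler_sum => w _.
    by case/andP: (T w).
  have : 0 <= a <= 1 by rewrite u_ge0 u_le1.
  have : 0 <= eta * x ^+ (#|W| + k) by rewrite mulr_ge0 ?exprn_ge0.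
  move: (eta * _) => z z0 /andP[a0 a1] /andP[b0 b1].
  apply: (@le_trans _ _ n.+2%:R).
    by rewrite ler_norml; move: b1; rewrite -!natr1; have := ler0n R n; lra.
  by rewrite -!natr1; have := ler0n R n; nra.
Qed.

Lemma sum_card_edges (W : {set V}) :
  \sum_e #|W :&: ed e|%:R <= #|W|%:R * (h * D).
Proof.
have -> : \sum_e #|W :&: ed e|%:R = \sum_(w in W) #|[set e | w \in ed e]|%:R :>
  R.
  rewrite -!natr_sum; congr (_%:R).
  transitivity (\sum_e \sum_(w in W | w \in ed e) 1)%N.
    by apply: eq_bigr => e _; rewrite -sum1_card; apply: eq_bigl => w;
      rewrite inE.
  rewrite (exchange_big_dep (mem W)) /= => [|e w _ /andP[]//].
  apply: eq_bigr => w wW; rewrite -sum1_card; apply: eq_bigl => e.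
  by rewrite inE wW.
by rewrite mulr_natl -sumr_const; apply: ler_sum => w _.
Qed.

(** The summand counts ordered pairs of distinct vertices of [W] in [e]; exchanging sums brings in
    the codegrees. *)
Lemma sum_card_edges2 (W : {set V}) :
  \sum_e (#|W :&: ed e|%:R * (#|W :&: ed e|%:R - 1))
  <= #|W|%:R ^+ 2 * (h * kappa * D).
Proof.
apply: (@le_trans _ _ (\sum_(w in W) \sum_(w' in W :\ w)
   #|[set e | (w \in ed e) && (w' \in ed e)]|%:R)).
  rewrite le_eqVlt; apply/orP; left; apply/eqP.
  transitivity (\sum_e \sum_(w in W | w \in ed e)
     \sum_(w' in W :\ w | w' \in ed e) 1 : R).
    apply: eq_bigr => e _.
    rewrite (eq_bigr (fun=> (#|W :&: ed e|%:R - 1))) => [|w /andP[wW we]].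
      rewrite sumr_const mulr_natl; congr (_ *+ _).
      by apply: eq_card => w; rewrite !inE.
    rewrite sumr_const (cardsD1 w (W :&: ed e)) inE wW we /= natrD addrAC subrr
      add0r.
    by congr (_%:R); apply: eq_card => w1; rewrite unfold_in /= !inE andbA.
  rewrite (exchange_big_dep (mem W)) /= => [|e w _ /andP[]//].
  apply: eq_bigr => w wW.
  rewrite (exchange_big_dep (mem (W :\ w))) /= => [|e w' _ /andP[]//].
  apply: eq_bigr => w' wW'; rewrite sumr_const; congr (_%:R).
  by apply: eq_card => e; rewrite unfold_in /= wW wW' inE.
rewrite expr2 -mulrA mulr_natl -sumr_const; apply: ler_sum => w wW.
apply: (@le_trans _ _ (\sum_(w' in W :\ w) h * kappa * D)).
  by apply: ler_sum => w'; rewrite !inE eq_sym => /andP[/codeg_le].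
rewrite sumr_const -[leLHS]mulr_natl.
apply: ler_wpM2r; last by rewrite ler_nat subset_leq_card ?subD1set.
by rewrite !mulr_ge0 // ltW.
Qed.

(** Three errors add up: the one inherited from time [t], the edge errors summed by double counting,
    and the linearisation error of the product at time [t.+1]. *)
Lemma factor_error_recr eta x t W : 0 <= eta -> 0 <= x ->
  factor_error eta x t ->
  `|u t.+1 W - Y t.+1 W| <= eta * x ^+ #|W| +
    h * #|W|%:R * (eta * x ^+ (#|W| + k) + (kappa + h) * #|W|%:R).
Proof.
move=> eta0 x0 err; rewrite u_recr.
pose b e := \sum_(w in W | w \in ed e) Y t (ed e) * Y t (W :\ w).
pose a e := if [disjoint ed e & W] then 0 else u t (W :|: ed e).
have aE : \sum_(e | ~~ [disjoint ed e & W]) u t (W :|: ed e) = \sum_e a e.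
  by rewrite big_mkcond; apply: eq_bigr => e _; rewrite /a; rewrite if_neg.
have bE : \sum_(w in W) mf_loss t w * Y t (W :\ w) = D^-1 * \sum_e b e.
  rewrite /b (exchange_big_dep (mem W)) /= => [|e w _ /andP[]//].
  rewrite mulr_sumr; apply: eq_bigr => w wW; rewrite /mf_loss -mulrA;
    congr (_ * _).
  rewrite mulr_suml; apply: eq_bigl => e.
  by rewrite -topredE /= wW.
have lossh w : 0 <= mf_loss t w <= h.
  have /andP[l0 l1] := mf_loss_le w (mf01 t); have /andP[m0 m1] := mf01 t w.
  by rewrite l0 /=; apply: le_trans l1 _; rewrite ler_piMr.
have := prod_sub_linear W (mf01 t) lossh.
have M0 w : 0 <= mf t w - mf_loss t w by have /andP[] := mf01 t.+1 w.
move=> /(_ M0); rewrite -[\prod_(_ in _) (_ - _)]/(Y t.+1 W) bE aE.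
set Y1 := Y t.+1 W; set Y0 := Y t W; set u0 := u t W.
have errW : `|u0 - Y0| <= eta * x ^+ #|W| by exact: err.
have ab : `|D^-1 * \sum_e b e - D^-1 * \sum_e a e| <=
    h * #|W|%:R * (eta * x ^+ (#|W| + k)) + h * kappa * #|W|%:R ^+ 2.
  rewrite -mulrBr -sumrB normrM gtr0_norm ?invr_gt0 // mulrC ler_pdivrMr //.
  apply: le_trans (ler_norm_sum _ _ _) _.
  apply: (@le_trans _ _ (\sum_e (#|W :&: ed e|%:R * (eta * x ^+ (#|W| + k)) +
      #|W :&: ed e|%:R * (#|W :&: ed e|%:R - 1)))).
    by apply: ler_sum => e _; rewrite distrC; exact: edge_error.
  rewrite big_split /= -mulr_suml mulrDl; apply: lerD.
    rewrite [leRHS]mulrAC ler_wpM2r ?mulr_ge0 ?exprn_ge0 //.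
    by rewrite [h * _]mulrC -mulrA; apply: sum_card_edges.
  by rewrite [h * kappa * _]mulrC -mulrA; apply: sum_card_edges2.
move=> prodE.
have -> : u0 - D^-1 * \sum_e a e - Y1 = (u0 - Y0) +
  (D^-1 * \sum_e b e - D^-1 * \sum_e a e) + - (Y1 - (Y0 - D^-1 * \sum_e b e)).
  by ring.
apply: le_trans (ler_normD _ _) _; rewrite normrN.
apply: le_trans (lerD (ler_normD _ _) (lexx _)) _.
apply: le_trans (lerD (lerD errW ab) prodE) _.
by rewrite le_eqVlt; apply/orP; left; apply/eqP; ring.
Qed.

(** The first term absorbs the factor [x ^+ k.+1] with [x <= 4] that comes from enlarging [W] by an
    edge, the second the codegree and linearisation errors. *)
Definition rate : R := 4 ^+ k.+1 + 1.

Lemma bernoulli (x a : R) n : 0 <= x -> 0 <= a ->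
  x ^+ n.+1 + n.+1%:R * x ^+ n * a <= (x + a) ^+ n.+1.
Proof.
move=> x0 a0; elim: n => [|n IH]; first by rewrite !expr1 expr0 !mulr1 mul1r.
rewrite [leRHS]exprS; apply: le_trans (ler_wpM2l _ IH); last exact: addr_ge0.
rewrite -(natr1 n.+1) exprS [x ^+ n.+1]exprS.
have : 0 <= n.+1%:R * x ^+ n * a * a by rewrite !mulr_ge0 ?exprn_ge0.
by move: (n.+1%:R) (x ^+ n) => N z; lra.
Qed.

Lemma ler_nat_expr2 (x : R) n : 2 <= x -> n.+1%:R <= x ^+ n.
Proof.
move=> x2; elim: n => [|n IH]; first by rewrite expr0.
rewrite exprS -natr1.
have : 1 <= x ^+ n by apply: exprn_ege1; lra.
by nra.
Qed.

(** The new error is proportional to [#|W|], as is the gain in [x ^+ #|W|] from raising the base, by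
    [bernoulli]. So [eta] is kept and the base grows; [2 <= x] gives [#|W| <= x ^+ #|W|.-1] for
    nonempty [W]. *)
Lemma factor_errorS eta x t : kappa + h <= eta -> 2 <= x -> x <= 4 ->
  factor_error eta x t -> factor_error eta (x + h * rate) t.+1.
Proof.
move=> eta_ge x2 x4 err W.
have eta0 : 0 <= eta by apply: le_trans eta_ge; apply: addr_ge0.
have x0 : 0 <= x by apply: le_trans x2.
apply: le_trans (factor_error_recr W eta0 x0 err) _.
have r0 : 0 <= rate by apply: addr_ge0; rewrite ?exprn_ge0.
case: #|W| => [|n].
  by rewrite mulr0 mul0r addr0 !expr0.
have hr0 : 0 <= h * rate by rewrite mulr_ge0.
apply: le_trans (ler_wpM2l eta0 (bernoulli n x0 hr0)).
rewrite [leRHS]mulrDr lerD2l.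
have -> : eta * (n.+1%:R * x ^+ n * (h * rate)) =
  h * n.+1%:R * (eta * (x ^+ n * rate)) by ring.
apply: ler_wpM2l; first by rewrite mulr_ge0.
rewrite /rate [x ^+ n * _]mulrDr mulr1 mulrDr; apply: lerD.
  apply: ler_wpM2l => //; rewrite addSnnS exprD ler_wpM2l ?exprn_ge0 //.
  by apply: lerXn2r; rewrite ?nnegrE //.
by apply: ler_pM => //; [apply: addr_ge0 | apply: ler_nat_expr2].
Qed.

Lemma factor_error_iter eta t n : kappa + h <= eta ->
  n%:R * (h * rate) <= 2 ->
  factor_error eta 2 t -> factor_error eta (2 + n%:R * (h * rate)) (n + t).
Proof.
move=> eta_ge nh err.
have r0 : 0 <= rate by apply: addr_ge0; rewrite ?exprn_ge0.
have hr0 : 0 <= h * rate by rewrite mulr_ge0.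
elim: n nh => [|n IH]; first by rewrite mul0r addr0.
rewrite -natr1 mulrDl mul1r addrA => nh.
have n0 : 0 <= n%:R * (h * rate) by rewrite mulr_ge0.
by apply: factor_errorS => //; [lra | lra | apply: IH; lra].
Qed.

Lemma u_sub_Y_le1 t W : `|u t W - Y t W| <= 1.
Proof.
have /andP[a0 a1] := Y01 t (mem W).
by have b0 := u_ge0 t W; have b1 := u_le1 t W; rewrite ler_norml; apply/andP;
  split; lra.
Qed.

(* The base of the error bound grows from 2 to 4 over a phase; since errors are
   at most 1, taking square roots brings it back to 2. *)
Lemma factor_error_phase eta t n : 0 <= eta -> kappa + h <= eta ^+ 2 ->
  n%:R * (h * rate) <= 2 ->
  factor_error (eta ^+ 2) 2 t -> factor_error eta 2 (n + t).
Proof.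
move=> eta0 eta_ge nh err W.
have r0 : 0 <= rate by apply: addr_ge0; rewrite ?exprn_ge0.
have hr0 : 0 <= h * rate by rewrite mulr_ge0.
have := factor_error_iter eta_ge nh err W.
set z := `|_|; have z1 : z <= 1 by exact: u_sub_Y_le1.
have z0 : 0 <= z by exact: normr_ge0.
move=> zle; rewrite -(@ler_pXn2r _ 2) ?nnegrE ?mulr_ge0 ?exprn_ge0 //.
apply: (@le_trans _ _ z); first by rewrite expr2 ler_piMr.
apply: le_trans zle _; rewrite exprMn ler_wpM2l ?exprn_ge0 //.
rewrite -exprM mulnC exprM; apply: lerXn2r; rewrite ?nnegrE.
- by rewrite addr_ge0 // mulr_ge0.
- exact: exprn_ge0.
- by rewrite expr2; lra.
Qed.

(** Each phase costs a square root, so [j] phases ending at [eta] start from [eta ^+ (2 ^ j)]. *)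
Lemma factor_error_phases eta n j : 0 <= eta <= 1 ->
  kappa + h <= eta ^+ (2 ^ j) -> n%:R * (h * rate) <= 2 ->
  factor_error eta 2 (j * n).
Proof.
move=> /andP[eta0 eta1] eta_ge nh;
  elim: j eta eta0 eta1 eta_ge => [|j IH] eta eta0 eta1 eta_ge.
  (* At time 0 both quantities equal 1. *)
  move=> W; rewrite mul0n /expect /= /unc /cov big_set0 -setI_eq0 setI0 eqxx.
  by rewrite big1_eq subrr normr0 mulr_ge0 ?exprn_ge0.
rewrite mulSn; apply: factor_error_phase => //.
  apply: le_trans eta_ge _; apply: ler_wiXn2l => //.
  by rewrite expnS -{1}[2%N]muln1 leq_mul2l expn_gt0.
apply: IH; rewrite ?exprn_ge0 ?exprn_ile1 //.
by rewrite -exprM -expnS.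
Qed.

End MeanField.
End RandomGreedy.

(** * Completing a partial matching *)

Section Transversal.
Variables (X S I : finType) (T : I -> S -> {set X}) (k : nat).
Hypothesis T_size : forall i s, #|T i s| = k.
Hypothesis T_deg : forall i x, #|[set s | x \in T i s]| = k.

(** The vertex [inr e.1] prevents a matching from containing two translates with the same index. *)
Definition block_edge (e : I * S) : {set X + I} :=
  (inl @: T e.1 e.2) :|: [set inr e.1].

Lemma in_block_edge_inl x e : (inl x \in block_edge e) = (x \in T e.1 e.2).
Proof. by rewrite !inE orbF mem_imset // => y z []. Qed.

Lemma in_block_edge_inr i e : (inr i \in block_edge e) = (i == e.1).
Proof.
rewrite !inE; case: imsetP => [[x _ //]|_] /=.
by apply/eqP/eqP => [[]|->].
Qed.

Lemma card_meets (i : I) (Z : {set X}) :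
  #|[set s | ~~ [disjoint T i s & Z]]| <= k * #|Z|.
Proof.
apply: (@leq_trans (\sum_(x in Z) #|[set s | x \in T i s]|)); last first.
  by under eq_bigr do rewrite T_deg; rewrite sum_nat_const mulnC.
apply: (@leq_trans (\sum_s #|T i s :&: Z|)).
  rewrite -sum1_card [leqRHS](bigID (mem [set s | ~~ [disjoint T i s & Z]])) /=.
  apply: leq_trans (leq_addr _ _); apply: leq_sum => s.
  by rewrite inE -setI_eq0 card_gt0.
rewrite (eq_bigr (fun s => \sum_(x in Z | x \in T i s) 1)) => [|s _].
  rewrite (exchange_big_dep (mem Z)) /= => [|s x _ /andP[]//].
  apply: leq_sum => x xZ; rewrite -sum1_card leq_eqVlt; apply/orP; left.
  by apply/eqP; apply: eq_bigl => s; rewrite inE; move: xZ => /= ->.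
by rewrite -sum1_card; apply: eq_bigl => x; rewrite inE andbC.
Qed.

(** By [card_meets] each occupied point rules out at most [k] shifts per index, and each placed
    block occupies [k] more points; [k * k * size L] reserves room for all of them. The element of
    [S] is a default value outside [L]. *)
Lemma greedy (L : seq I) (Z : {set X}) (C : I -> {set S}) : uniq L ->
  (forall i, i \in L -> k * #|Z| + k * k * size L < #|C i|) ->
  S -> exists sel : I -> S,
  (forall i, i \in L -> sel i \in C i /\ [disjoint T i (sel i) & Z]) /\
  (forall i j, i \in L -> j \in L -> i != j ->
     [disjoint T i (sel i) & T j (sel j)]).
Proof.
move=> uL CL s0; elim: L Z uL CL => [|i L IH] Z /=; first by exists (fun=> s0).
case/andP=> iL uL CL.
have [s sC sZ] : exists2 s, s \in C i & [disjoint T i s & Z].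
  have: 0 < #|C i :\: [set s | ~~ [disjoint T i s & Z]]|.
    rewrite cardsD subn_gt0; apply: leq_ltn_trans (CL i _);
      last exact: mem_head.
    apply: leq_trans (leq_addr _ _).
    by apply: leq_trans (card_meets i Z); apply: subset_leq_card;
      apply: subsetIr.
  by case/card_gt0P=> s; rewrite !inE negbK => /andP[]; exists s.
have [j jL|sel [selC selD]] := IH (Z :|: T i s) uL.
  apply: leq_ltn_trans (CL j _); last by rewrite inE jL orbT.
  have : #|Z :|: T i s| <= #|Z| + k by rewrite -(T_size i s) cardsU leq_subr.
  by nia.
have neq j : j \in L -> (j == i) = false.
  by move=> jL; apply/eqP => e; rewrite -e jL in iL.
have selZ j : j \in L -> [disjoint T j (sel j) & Z] /\ [disjoint T j (sel j) &
  T i s].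
  move=> /selC[_]; rewrite -!setI_eq0 setIUr setU_eq0; by case/andP.
exists (fun j => if j == i then s else sel j); split.
  move=> j; rewrite inE; case: eqP => [-> _ //|_ /= jL].
  by split; [case: (selC j jL) | case: (selZ j jL)].
move=> j j'; rewrite !inE.
case: (eqVneq j i) => [->|ne]; case: (eqVneq j' i) => [->|ne'] /=.
- by [].
- by move=> _ jL _; rewrite disjoint_sym; case: (selZ _ jL).
- by move=> jL _ _; case: (selZ _ jL).
- exact: selD.
Qed.

(* All bad indices are placed first, regardless of [M]; the blocks of [M] they
   meet are discarded, and their indices join the uncovered ones, all of which
   are good and hence have enough room left. *)
Lemma complete_matching (M : {set I * S}) (Bad : {set I}) :
  matching block_edge M ->
  k * k * #|Bad| < #|S| ->
  (forall i, i \notin Bad ->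
     k * (k * #|Bad|) +
     k * k * (#|[set j | inr j \notin cov block_edge M]| + k * #|Bad|) <
     #|[set s | [disjoint inl @: T i s & cov block_edge M]]|) ->
  exists sel : I -> S,
    forall i j, i != j -> [disjoint T i (sel i) & T j (sel j)].
Proof.
move=> mM Bad_small good.
have [s0] : exists s0 : S, true by case/card_gt0P: (leq_ltn_trans (leq0n _)
  Bad_small) => s; exists s.
move=> _.
have [i|sel1 [_ sel1D]] := @greedy (enum Bad) set0 (fun=> setT) (enum_uniq _) _
  s0.
  by rewrite cards0 muln0 -cardE cardsT.
pose Z := \bigcup_(i in Bad) T i (sel1 i).
have Z_card : #|Z| <= k * #|Bad|.
  rewrite mulnC -sum_nat_const.
  apply: (@leq_trans (\sum_(i in Bad) #|T i (sel1 i)|)); last first.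
    by apply: leq_sum => i _; rewrite T_size.
  rewrite /Z; elim/big_rec2: _ => [|i n A _ IH]; first by rewrite cards0.
  by rewrite (leq_trans (leq_card_setU _ _)) // leq_add2l.
(* The good indices that have no block in [M], or whose block in [M] meets [Z]. *)
pose L2 := [set i | (i \notin Bad) &&
  ~~ [exists s, ((i, s) \in M) && [disjoint T i s & Z]]].
have L2_card : #|L2| <= #|[set j | inr j \notin cov block_edge M]| + k * #|Bad|.
  (* Blocks of [M] are disjoint, so a point of [Z] lies in at most one of them; thus at most [#|Z|]
     blocks are discarded. *)
  pose hit x := omap fst [pick e in M | x \in T e.1 e.2].
  pose L2' := L2 :\: [set j | inr j \notin cov block_edge M].
  have L2'_card : #|L2'| <= #|Z|.
    rewrite -(card_imset _ (@Some_inj _)).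
    apply: leq_trans (leq_imset_card hit Z); apply: subset_leq_card.
    apply/subsetP => _ /imsetP[i iL ->]; move: iL; rewrite !inE negbK.
    case/and3P=> /bigcupP[[i' s] eM];
      rewrite in_block_edge_inr /= => /eqP ii' _.
    subst i' => /existsPn/(_ s); rewrite eM /= -setI_eq0.
    case/set0Pn=> x; rewrite inE => /andP[xT xZ].
    apply/imsetP; exists x => //; rewrite /hit;
      case: pickP => [e /andP[eM' xe]|].
      have [<-//|ne] := eqVneq (i, s) e.
      have := mM _ _ eM eM' ne; rewrite -setI_eq0 => /eqP H.
      have : inl x \in block_edge (i, s) :&: block_edge e.
        by rewrite inE !in_block_edge_inl xT.
      by rewrite H inE.
    by move/(_ (i, s)); rewrite eM /= xT.
  have := cardsID [set j | inr j \notin cov block_edge M] L2.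
  rewrite -/L2' => <-; apply: leq_add; last exact: leq_trans Z_card.
  by apply: subset_leq_card; apply: subsetIr.
have [i|sel2 [sel2C sel2D]] := @greedy (enum L2) Z
   (fun i => [set s | [disjoint inl @: T i s & cov block_edge M]]) (enum_uniq
     _) _ s0.
  rewrite mem_enum inE => /andP[iB _].
  apply: leq_ltn_trans (good i iB); rewrite -cardE.
  by apply: leq_add; rewrite leq_mul2l ?Z_card ?L2_card orbT.
(* The default is never taken at an index where [sel] uses [selM]. *)
pose selM i := odflt s0 [pick s | ((i, s) \in M) && [disjoint T i s & Z]].
pose sel i := if i \in Bad then sel1 i else if i \in L2 then sel2 i else selM i.
have selMP i : i \notin Bad -> i \notin L2 ->
   (i, selM i) \in M /\ [disjoint T i (selM i) & Z].
  move=> iB; rewrite inE iB /= negbK => /existsP[s sP].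
  by rewrite /selM; case: pickP => [s' /andP[]//|/(_ s)]; rewrite sP.
have inZ i : i \in Bad -> T i (sel1 i) \subset Z.
  by move=> iB; apply: (bigcup_sup i).
have sel2P i : i \in L2 -> [disjoint inl @: T i (sel2 i) & cov block_edge M] /\
    [disjoint T i (sel2 i) & Z].
  by rewrite -mem_enum => /sel2C[]; rewrite inE.
(* Candidates for [L2] avoid everything covered by [M], hence also the blocks kept from [M]. *)
have dis2M i j : i \in L2 -> j \notin Bad -> j \notin L2 ->
    [disjoint T i (sel2 i) & T j (selM j)].
  move=> /sel2P[d _] jB jL; have [jM _] := selMP j jB jL.
  rewrite -setI_eq0 -subset0; apply/subsetP => x; rewrite inE => /andP[xi xj].
  move: d; rewrite -setI_eq0 => /eqP/setP/(_ (inl x)); rewrite !inE.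
  rewrite imset_f //= => /negbT/negP[]; apply/bigcupP; exists (j, selM j) => //.
  by rewrite in_block_edge_inl.
exists sel => i j ne; rewrite /sel.
case: (boolP (i \in Bad)) => iB; case: (boolP (j \in Bad)) => jB.
- by apply: sel1D; rewrite ?mem_enum.
- rewrite disjoint_sym; apply: disjointWr (inZ i iB) _.
  by case: ifP => [/sel2P[]//|/negbT /(selMP _ jB)[]].
- apply: disjointWr (inZ j jB) _.
  by case: ifP => [/sel2P[]//|/negbT /(selMP _ iB)[]].
case: (boolP (i \in L2)) => iL; case: (boolP (j \in L2)) => jL.
- by apply: sel2D; rewrite ?mem_enum.
- exact: dis2M.
- by rewrite disjoint_sym; apply: dis2M.
have [iM _] := selMP i iB iL; have [jM _] := selMP j jB jL.
have ne' : (i, selM i) != (j, selM j) by apply: contraNneq ne => -[->].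
have := mM _ _ iM jM ne'; rewrite -!setI_eq0 => /eqP/setP H.
rewrite -subset0; apply/subsetP => x; rewrite inE => /andP[xi xj].
by have := H (inl x); rewrite in_setI !in_block_edge_inl /= xi xj inE.
Qed.

End Transversal.

(** * Disjoint transversals of families of translates *)

Section Density.
Local Open Scope ring_scope.
Variables (R : realFieldType) (X S I : finType) (T : I -> S -> {set X}).
Variables (k Lam v : nat) (c : R).
Hypothesis k_gt0 : (0 < k)%N.
Hypothesis v_gt0 : (0 < v)%N.
Hypothesis T_size : forall i s, #|T i s| = k.
Hypothesis T_deg : forall i x, #|[set s | x \in T i s]| = k.
Hypothesis T_codeg : forall x y, x != y ->
  (#|[set e : I * S | (x \in T e.1 e.2) && (y \in T e.1 e.2)]| <= Lam)%N.
Hypothesis S_card : #|S| = v.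
Hypothesis c_gt0 : 0 < c.
Hypothesis I_card : (k * #|I|)%:R <= (1 - c) * v%:R.

Notation ed := (block_edge T).
(** Each orbit vertex has degree [v], so it is hit with probability [1 / v] per step, and time is
    naturally measured in units of [v]. *)
Notation D := ((v * v)%:R : R).

Lemma vR_gt0 : 0 < v%:R :> R.
Proof. by rewrite ltr0n. Qed.

Lemma card_block_edge e : #|ed e| = k.+1.
Proof.
rewrite /block_edge setUC cardsU1 card_imset; last by move=> x y [].
by rewrite T_size; case: imsetP => [[x _ //]|].
Qed.

Lemma block_degree_inr i : #|[set e | inr i \in ed e]| = v.
Proof.
have -> : [set e | inr i \in ed e] = setX [set i] setT.
  by apply/setP => -[j s]; rewrite in_set in_block_edge_inr !inE andbT eq_sym.
by rewrite cardsX cards1 mul1n cardsT S_card.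
Qed.

Lemma block_degree_inl x : #|[set e | inl x \in ed e]| = (k * #|I|)%N.
Proof.
rewrite -sum1_card.
rewrite (eq_bigl (fun e => x \in T e.1 e.2)) => [|e]; last first.
  by rewrite in_set in_block_edge_inl.
rewrite mulnC -sum_nat_const -(pair_big_dep predT (fun i s => x \in T i s) (fun
  _ _ => 1%N)) /=.
apply: eq_bigr => i _; rewrite -(T_deg i x) -sum1_card.
by apply: eq_bigl => s; rewrite inE.
Qed.

Lemma kI_lt_v : (k * #|I| < v)%N.
Proof. by rewrite -(ltr_nat R); have := vR_gt0; move: I_card c_gt0; nra. Qed.

Lemma card_edges_lt : #|{: I * S}|%:R < D.
Proof.
rewrite ltr_nat card_prod S_card ltn_pmul2r //; apply: leq_ltn_trans kI_lt_v.
exact: leq_pmull.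
Qed.

Lemma block_degree w : #|[set e | w \in ed e]|%:R <= v%:R^-1 * D :> R.
Proof.
rewrite natrM mulKf ?gt_eqF ?vR_gt0 // ler_nat.
by case: w => w; rewrite ?block_degree_inr // block_degree_inl ltnW // kI_lt_v.
Qed.

(** Two points share at most [Lam] edges, a point and an orbit at most [k], and two distinct orbits
    none. *)
Lemma block_codegree w w' : w != w' ->
  #|[set e | (w \in ed e) && (w' \in ed e)]|%:R <=
    v%:R^-1 * ((Lam + k)%:R / v%:R) * D :> R.
Proof.
move=> ne.
have -> : v%:R^-1 * ((Lam + k)%:R / v%:R) * D = (Lam + k)%:R.
  by rewrite [D]natrM; field; rewrite gt_eqF ?vR_gt0.
rewrite ler_nat.
have mixed x i : (#|[set e | (inl x \in ed e) && (inr i \in ed e)]| <= Lam +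
  k)%N.
  apply: (@leq_trans #|[set s | x \in T i s]|); last by rewrite T_deg leq_addl.
  apply: leq_trans (leq_imset_card (pair i) _); apply: subset_leq_card.
  apply/subsetP => -[j s];
    rewrite in_set in_block_edge_inl in_block_edge_inr /=.
  by case/andP=> xT /eqP ij; subst j; rewrite imset_f // inE.
case: w w' ne => [x|i] [y|j] ne //.
- apply: leq_trans (leq_addr _ _);
  apply: leq_trans (T_codeg (x := x) (y := y) _) => //.
  by apply: subset_leq_card; apply/subsetP => e;
    rewrite in_set !in_block_edge_inl => xy; rewrite in_set.
- under eq_finset do rewrite andbC; exact: mixed.
- rewrite (_ : [set e | _] = set0) ?cards0 //; apply/setP => e.
  rewrite in_set !in_block_edge_inr in_set0;
    apply/negP => /andP[/eqP ei /eqP ej].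
  by rewrite ei ej eqxx in ne.
Qed.

(** Conservation law: each covered orbit uses [k] points, so the proportion of uncovered points is
    affine in the proportion [y] of uncovered orbits. *)
Definition point_density (y : R) : R := 1 - (k * #|I|)%:R / v%:R * (1 - y).

Fixpoint orbit_density (t : nat) : R :=
  if t is t'.+1 then
    orbit_density t' * (1 - v%:R^-1 * point_density (orbit_density t') ^+ k)
  else 1.

Local Notation g := orbit_density.
Local Notation f t := (point_density (g t)).

Lemma prod_block_edge (F : X + I -> R) e :
  \prod_(z in ed e) F z = \prod_(x in T e.1 e.2) F (inl x) * F (inr e.1).
Proof.
rewrite /block_edge setUC big_setU1 /= 1?mulrC; last first.
  by case: imsetP => // -[].
by rewrite big_imset // => x y _ _ [].
Qed.

(** All points have the same degree and so have all orbits; hence the recursion has only two values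
    at each time, and it preserves the conservation law. *)
Lemma mf_block t w : mf ed D t w = if w is inl _ then f t else g t.
Proof.
elim: t w => [|t IH] w.
  by case: w => w //=; rewrite /point_density subrr mulr0 subr0.
rewrite /=.
have E e : \prod_(z in ed e) mf ed D t z = f t ^+ k * g t.
  rewrite prod_block_edge IH; congr (_ * _).
  by under eq_bigr do rewrite IH; rewrite prodr_const T_size.
under eq_bigr do rewrite E.
rewrite sumr_const -[f t ^+ k * g t *+ _]mulr_natl.
have -> : #|(fun e => w \in ed e)| = #|[set e | w \in ed e]|.
  by apply: eq_card => e; rewrite in_set.
rewrite IH; have v0 := vR_gt0; case: w => w.
  rewrite block_degree_inl /point_density [D]natrM.
  by field; rewrite gt_eqF.
by rewrite block_degree_inr [D]natrM; field; rewrite gt_eqF.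
Qed.

Lemma point_density_bounds y : 0 <= y <= 1 -> c <= point_density y <= 1.
Proof.
case/andP=> y0 y1; have v0 := vR_gt0; rewrite /point_density.
have : 0 <= ((k * #|I|)%:R / v%:R : R) <= 1 - c.
  by rewrite divr_ge0 //= ler_pdivrMr.
by move: (_ / _) => a /andP[a0 a1]; nra.
Qed.

(** As the point density stays at least [c], each step multiplies [g] by at most [1 - a] with
    [a = c ^+ k / v]. The inequality [(1 - a) * (1 + (t + 1) * a) <= 1 + t * a] turns this decay
    into a rational bound. *)
Lemma orbit_density_bounds t :
  0 <= g t /\ g t * (1 + t%:R * (v%:R^-1 * c ^+ k)) <= 1.
Proof.
have vi0 : 0 < v%:R^-1 :> R by rewrite invr_gt0 vR_gt0.
have vi1 : v%:R^-1 <= 1 :> R by rewrite invf_le1 ?vR_gt0 // ler1n.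
elim: t => [|t [g0 g1]] /=; first by rewrite mul0r addr0 mulr1.
have a0 : 0 <= v%:R^-1 * c ^+ k by rewrite mulr_ge0 ?exprn_ge0 // ltW.
have t0 := ler0n R t.
have g01 : 0 <= g t <= 1.
  rewrite g0 (le_trans _ g1) // ler_peMr // lerDl mulr_ge0 //.
have /andP[f0 f1] := point_density_bounds g01.
have f0' : 0 <= f t by apply: le_trans f0; apply: ltW.
have fk1 : v%:R^-1 * f t ^+ k <= 1.
  by rewrite mulr_ile1 ?exprn_ge0 ?exprn_ile1 // ltW.
have fkc : v%:R^-1 * c ^+ k <= v%:R^-1 * f t ^+ k.
  apply: ler_wpM2l; first exact: ltW.
  by apply: lerXn2r; rewrite ?nnegrE // ltW.
split; first by rewrite mulr_ge0 ?subr_ge0.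
apply: le_trans g1; rewrite -mulrA; apply: ler_wpM2l => //.
rewrite -natr1; move: (_ * c ^+ k) (_ * f t ^+ k) a0 fk1 fkc => a b a0 b1 ab.
have ta0 : 0 <= 1 + (t%:R + 1) * a by rewrite !addr_ge0 ?mulr_ge0 ?addr_ge0.
apply: (@le_trans _ _ ((1 - a) * (1 + (t%:R + 1) * a))).
  by apply: ler_wpM2r => //; lra.
have : 0 <= (t%:R + 1) * (a * a) by rewrite !mulr_ge0 ?addr_ge0.
by lra.
Qed.

Lemma orbit_density01 t : 0 <= g t <= 1.
Proof.
have [g0 g1] := orbit_density_bounds t; rewrite g0 (le_trans _ g1) //.
by rewrite ler_peMr // lerDl !mulr_ge0 ?invr_ge0 ?exprn_ge0 // ltW.
Qed.

Lemma f_bounds t : c <= f t <= 1.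
Proof. exact/point_density_bounds/orbit_density01. Qed.

(** * Second moment of the number of free translates *)

Local Notation u t W := (expect ed D t (unc R ed W)).

Definition free_shifts (i : I) (M : {set I * S}) : R :=
  \sum_s unc R ed (inl @: T i s) M.

Lemma sum_shifts_const (a : R) : \sum_(s : S) a = v%:R * a.
Proof. by rewrite sumr_const S_card mulr_natl. Qed.

Section Moments.
Variables (eta : R) (t : nat).
Hypothesis eta_ge0 : 0 <= eta.
Hypothesis err : factor_error ed D eta 2 t.

Lemma u_inr i : u t [set inr i] <= g t + 2 * eta.
Proof.
have := err [set inr i]; rewrite big_set1 mf_block cards1 expr1 ler_norml.
by case/andP; lra.
Qed.

Lemma u_inl (A : {set X}) : `|u t (inl @: A) - f t ^+ #|A| | <= eta * 2 ^+ #|A|.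
Proof.
have inlI : injective (@inl X I) by move=> x y [].
have := err (inl @: A);
  rewrite (card_imset _ inlI) big_imset /= => [|x y _ _ []//].
by under eq_bigr do rewrite mf_block; rewrite prodr_const.
Qed.

(** Disjoint translates form a set of [2 * k] points, nearly independent with error
    [eta * 2 ^+ (2 * k)]; overlapping ones are bounded by 1, and each translate overlaps at most
    [k * k] of its orbit. *)
Lemma u_pair i s s' :
  u t (inl @: T i s :|: inl @: T i s') <=
  f t ^+ k * f t ^+ k + eta * 4 ^+ k + (~~ [disjoint T i s' & T i s])%:R.
Proof.
have f0 : 0 <= f t ^+ k by rewrite exprn_ge0 // (le_trans (ltW c_gt0)) //;
  case/andP: (f_bounds t).
have e0 : 0 <= eta * 4 ^+ k by rewrite mulr_ge0 ?exprn_ge0.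
case: (boolP [disjoint _ & _]) => dis /=; last first.
  have := u_le1 ed card_edges_lt t (inl @: T i s :|: inl @: T i s').
  have : 0 <= f t ^+ k * f t ^+ k by apply: mulr_ge0.
  by rewrite mulr1n; lra.
have := u_inl (T i s :|: T i s'); rewrite imsetU.
rewrite cardsU !T_size setIC (eqP (_ : T i s' :&: T i s == set0)) ?setI_eq0 //.
rewrite cards0 subn0 exprD exprD ler_norml -exprMn.
have -> : (2 * 2 : R) = 4 by rewrite -natrM.
by case/andP; rewrite addr0; lra.
Qed.

Lemma sum_u_pair i :
  \sum_s \sum_s' u t (inl @: T i s :|: inl @: T i s') <=
  v%:R ^+ 2 * (f t ^+ k * f t ^+ k + eta * 4 ^+ k) + v%:R * (k * k)%:R.
Proof.
have -> : v%:R ^+ 2 * (f t ^+ k * f t ^+ k + eta * 4 ^+ k) + v%:R * (k * k)%:R =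
  v%:R * (v%:R * (f t ^+ k * f t ^+ k + eta * 4 ^+ k) + (k * k)%:R) by ring.
rewrite -sum_shifts_const; apply: ler_sum => s _.
apply: le_trans (ler_sum _ (fun s' _ => u_pair i s s')) _.
rewrite big_split /= sum_shifts_const lerD2l.
rewrite -natr_sum ler_nat -[X in (_ <= _ * X)%N](T_size i s).
apply: leq_trans (card_meets T_deg i (T i s));
  rewrite -sum1_card [leqRHS]big_mkcond /=.
by apply: leq_sum => s' _; rewrite inE; case: (~~ _).
Qed.

(** Expand the square: the quadratic term contributes [eta * 4 ^+ k], the cross term at most
    [2 * eta * 4 ^+ k], and overlapping pairs the rest. *)
Lemma free_shifts_variance i :
  expect ed D t (fun M => (free_shifts i M / v%:R - f t ^+ k) ^+ 2) <=
  3 * 4 ^+ k * eta + (k * k)%:R / v%:R.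
Proof.
have v0 := vR_gt0.
pose q := f t ^+ k.
have E M : (free_shifts i M / v%:R - q) ^+ 2 =
  v%:R ^- 2 * (\sum_s \sum_s' unc R ed (inl @: T i s :|: inl @: T i s') M)
  + (- (2 * q / v%:R) * (\sum_s unc R ed (inl @: T i s) M) + q ^+ 2).
  have -> : \sum_s \sum_s' unc R ed (inl @: T i s :|: inl @: T i s') M =
    free_shifts i M ^+ 2.
    rewrite expr2 /free_shifts mulr_suml; apply: eq_bigr => s _.
    by rewrite mulr_sumr; apply: eq_bigr => s' _; rewrite uncU.
  by rewrite -/(free_shifts i M); field; rewrite gt_eqF.
rewrite (eq_expect _ _ _ E) !expectD !expectZ expect_cst !expect_sum.
under eq_bigr do rewrite expect_sum.
have H1 := sum_u_pair i.
have H2 : v%:R * (q - eta * 2 ^+ k) <= \sum_s u t (inl @: T i s).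
  rewrite -sum_shifts_const; apply: ler_sum => s _.
  by have := u_inl (T i s); rewrite T_size ler_norml => /andP[]; rewrite /q;
    lra.
have /andP[f0 f1] := f_bounds t.
have f0' : 0 <= f t by apply: le_trans f0; apply: ltW.
have q0 : 0 <= q by apply: exprn_ge0.
have q1 : q <= 1 by apply: exprn_ile1.
have le24 : 2 ^+ k <= 4 ^+ k :> R by apply: lerXn2r; rewrite ?nnegrE //; lra.
have p2 : 0 <= 2 ^+ k :> R by apply: exprn_ge0.
set A := \sum_s \sum_s' _ in H1 *; set B := \sum_s _ in H2 *.
have A1 : v%:R ^- 2 * A <= q * q + eta * 4 ^+ k + (k * k)%:R / v%:R.
  rewrite mulrC ler_pdivrMr ?exprn_gt0 //; apply: le_trans H1 _.
  rewrite -/q le_eqVlt; apply/orP; left; apply/eqP; field; rewrite gt_eqF //.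
have B1 : q - eta * 2 ^+ k <= v%:R^-1 * B.
  by rewrite [leRHS]mulrC ler_pdivlMr // mulrC.
have -> : - (2 * q / v%:R) * B = - (2 * q * (v%:R^-1 * B)) by ring.
have : q * (q - eta * 2 ^+ k) <= q * (v%:R^-1 * B) by apply: ler_wpM2l.
have : q * (eta * 2 ^+ k) <= eta * 4 ^+ k.
  apply: (@le_trans _ _ (eta * 2 ^+ k)); last exact: ler_wpM2l.
  by rewrite ler_piMl // mulr_ge0.
by lra.
Qed.

End Moments.

Lemma free_shifts_card i M :
  free_shifts i M = #|[set s | [disjoint inl @: T i s & cov ed M]]|%:R.
Proof.
rewrite /free_shifts -natr_sum -sum1_card; congr (_%:R).
by rewrite [RHS]big_mkcond; apply: eq_bigr => s _; rewrite inE; case: ifP.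
Qed.

Lemma uncovered_card M :
  \sum_i unc R ed [set inr i] M = #|[set j | inr j \notin cov ed M]|%:R.
Proof.
rewrite -natr_sum -sum1_card; congr (_%:R).
by rewrite [RHS]big_mkcond; apply: eq_bigr => i _; rewrite inE disjoints1;
  case: ifP.
Qed.

(** A single first moment argument, applied to the number of uncovered orbits plus weighted squared
    deviations, yields one matching with few uncovered orbits and few exceptional ones. *)
Lemma transversal_of_factor_error eta t beta : 0 <= eta ->
  factor_error ed D eta 2 t ->
  g t + 2 * eta + 4 / c ^+ k ^+ 2 * (3 * 4 ^+ k * eta + (k * k)%:R / v%:R)
    <= beta ->
  4 * (k * k * (k + 2))%:R * beta <= c ^+ k ->
  exists sel : I -> S,
    forall i j, i != j -> [disjoint T i (sel i) & T j (sel j)].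
Proof.
move=> eta0 err beta_ge beta_le.
have v0 := vR_gt0.
have ck0 : 0 < c ^+ k by rewrite exprn_gt0.
(* With this weight, a deviation of at least [c ^+ k / 2] counts at least 1, as in Chebyshev's
   inequality. *)
pose b := 4 / c ^+ k ^+ 2.
have b0 : 0 <= b by rewrite divr_ge0 // exprn_ge0 // ltW.
have beta0 : 0 <= beta.
  apply: le_trans beta_ge; have /andP[g0 _] := orbit_density01 t.
  apply: addr_ge0; first by apply: addr_ge0 => //; apply: mulr_ge0.
  apply: mulr_ge0 => //; apply: addr_ge0; last exact: divr_ge0.
  by do 2!apply: mulr_ge0 => //; apply: exprn_ge0.
pose dev i M := (free_shifts i M / v%:R - f t ^+ k) ^+ 2.
pose phi M := \sum_i (unc R ed [set inr i] M + b * dev i M).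
have /(matching_le_expect card_edges_lt)[M mM] : expect ed D t phi <= v%:R *
  beta.
  rewrite expect_sum; apply: (@le_trans _ _ (\sum_(i : I) beta)).
    apply: ler_sum => i _; rewrite expectD expectZ; apply: le_trans beta_ge.
    apply: lerD; first exact: u_inr.
    by apply: ler_wpM2l => //; apply: free_shifts_variance.
  rewrite sumr_const -[beta *+ _]mulr_natl ler_wpM2r // ler_nat.
  by apply: leq_trans (ltnW kI_lt_v); apply: leq_pmull.
rewrite /phi big_split /= uncovered_card.
set left := #|_|; set devs := \sum_i _ => phi_le.
have devs0 : 0 <= devs by apply: sumr_ge0 => i _; rewrite mulr_ge0 ?sqr_ge0.
have left_le : left%:R <= v%:R * beta by move: phi_le devs0; lra.
(* The threshold is half of a lower bound for the mean field value [f t ^+ k]. *)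
pose Bad := [set i | free_shifts i M / v%:R < c ^+ k / 2].
have fck : c ^+ k <= f t ^+ k.
  have /andP[f0 f1] := f_bounds t.
  by apply: lerXn2r; rewrite ?nnegrE ?(le_trans _ f0) // ltW.
have Bad_le : #|Bad|%:R <= v%:R * beta.
  apply: (@le_trans _ _ devs); last by move: phi_le (ler0n R left); lra.
  rewrite -sumr_const /devs [leRHS](bigID (mem Bad)) /=.
  apply: ler_wpDr; first by apply: sumr_ge0 => i _; rewrite mulr_ge0 ?sqr_ge0.
  apply: ler_sum => i; rewrite inE => iB.
  rewrite /b mulrAC ler_pdivlMr ?exprn_gt0 // mul1r /dev.
  move: (_ / _) iB => z iB; rewrite !expr2.
  move: (f t ^+ k) (c ^+ k) fck ck0 iB => q a qa a0 za.
  have : (a / 2) * (a / 2) <= (q - z) * (q - z) by apply: ler_pM; lra.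
  by lra.
have ck1 : c ^+ k <= 1.
  apply: exprn_ile1; first exact: ltW.
  by have /andP[f0 f1] := f_bounds t; apply: le_trans f1.
have k0 : 0 < k%:R :> R by rewrite ltr0n.
have kk0 : 0 < k%:R * k%:R :> R by rewrite mulr_gt0.
have bk : 4 * (k%:R * k%:R * (k%:R + 2)) * beta <= c ^+ k.
  by move: beta_le; rewrite !natrM natrD.
have Badk : k%:R * k%:R * #|Bad|%:R <= k%:R * k%:R * (v%:R * beta) by apply:
  ler_wpM2l; rewrite // ltW.
have kb0 : 0 <= k%:R * k%:R * beta by rewrite mulr_ge0 // ltW.
have kkb0 : 0 <= k%:R * (k%:R * k%:R * beta) by rewrite mulr_ge0 // ltW.
apply: (complete_matching T_size T_deg mM (Bad := Bad)).
  rewrite S_card -(ltr_nat R) !natrM; apply: le_lt_trans Badk _.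
  rewrite mulrCA -[ltRHS]mulr1 ltr_pM2l //; lra.
move=> i; rewrite inE -leNgt free_shifts_card ler_pdivlMr // => Ni.
rewrite -(ltr_nat R); apply: lt_le_trans Ni.
rewrite -/left !natrD !natrM !natrD !natrM.
(* The [k + 2] collects one share from [Z], one from the uncovered orbits and [k] from the discarded
   blocks. *)
apply: (@le_lt_trans _ _ (v%:R * (k%:R * k%:R * (k%:R + 2) * beta))).
  have H1 : k%:R * k%:R * left%:R <= k%:R * k%:R * (v%:R * beta) by apply:
    ler_wpM2l; rewrite // ltW.
  have H2 : k%:R * (k%:R * k%:R * #|Bad|%:R) <= k%:R * (k%:R * k%:R * (v%:R *
    beta)).
    by apply: ler_wpM2l; rewrite // ltW.
  by lra.
by rewrite mulrC ltr_pM2r //; lra.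
Qed.

(** The budget [beta] is split into a quarter for the orbit density after [j] phases, a half for the
    terms in [eta], and a quarter for overlapping translates. *)
Lemma transversal_exists (eta beta : R) (j : nat) : 0 <= eta <= 1 ->
  (4 ^ k.+1 + 1 <= v)%N ->
  (Lam + k + 1)%:R / v%:R <= eta ^+ (2 ^ j) ->
  4 * (4 ^ k.+1 + 1)%:R <= j%:R * c ^+ k * beta ->
  (2 + 12 * 4 ^+ k / c ^+ k ^+ 2) * eta <= beta / 2 ->
  4 / c ^+ k ^+ 2 * ((k * k)%:R / v%:R) <= beta / 4 ->
  4 * (k * k * (k + 2))%:R * beta <= c ^+ k ->
  exists sel : I -> S,
    forall i j, i != j -> [disjoint T i (sel i) & T j (sel j)].
Proof.
move=> eta01; set r := (4 ^ k.+1 + 1)%N => rv small j_ge eta_le v_ge beta_le.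
have v0 := vR_gt0.
have vi0 : 0 < v%:R^-1 :> R by rewrite invr_gt0 vR_gt0.
have vi1 : v%:R^-1 <= 1 :> R by rewrite invf_le1 ?vR_gt0 // ler1n.
have r0 : (0 < r)%N by rewrite /r addn1.
have rateE : rate R k = r%:R by rewrite /rate /r natrD natrX.
(* The longest phase keeping the base at most 4; since [r <= v], it still has at least [v / r]
   steps. *)
pose n := ((2 * v) %/ r)%N.
have n_le : (n * r <= 2 * v)%N by apply: leq_trunc_div.
have n_ge : (v <= n * r)%N.
  have := divn_eq (2 * v) r; rewrite -/n; have := ltn_pmod (2 * v) r0; lia.
have eta0 : 0 <= eta by case/andP: eta01.
have err : factor_error ed D eta 2 (j * n).
  apply: (factor_error_phases card_edges_lt card_block_edge _ _ vi1
           block_degree block_codegree eta01).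
  - exact: ltW.
  - by rewrite divr_ge0.
  - apply: le_trans small; rewrite [in leRHS]natrD mulrDl lerD2l mul1r //.
  - rewrite rateE mulrCA mulrC ler_pdivrMr // -!natrM ler_nat //.
apply: (transversal_of_factor_error eta0 err _ beta_le).
have [g0 g1] := orbit_density_bounds (j * n).
have ck0 : 0 < c ^+ k by rewrite exprn_gt0.
have gj : g (j * n) <= beta / 4.
  have jc : 0 < j%:R * c ^+ k * beta.
    by apply: lt_le_trans j_ge; rewrite mulr_gt0 // ltr0n.
  have rR : 0 < r%:R :> R by rewrite ltr0n.
  have : g (j * n) * (j%:R * c ^+ k) <= r%:R.
    apply: (@le_trans _ _ (g (j * n) * (1 + (j * n)%:R * (v%:R^-1 * c ^+ k)) *
      r%:R)).
      rewrite -mulrA; apply: ler_wpM2l => //.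
      have : 1 <= n%:R * r%:R / v%:R :> R.
        by rewrite ler_pdivlMr // mul1r -natrM ler_nat.
      have jc0 : 0 <= j%:R * c ^+ k by rewrite mulr_ge0 // ltW.
      move=> /(ler_wpM2l jc0); rewrite mulr1 natrM => H; apply: le_trans H _.
      have -> : j%:R * c ^+ k * (n%:R * r%:R / v%:R) =
         j%:R * n%:R * (v%:R^-1 * c ^+ k) * r%:R by ring.
      by rewrite ler_wpM2r ?lerDr // ltW.
    by rewrite -[leRHS]mul1r ler_wpM2r // ltW.
  move: j_ge jc g0; move: (g _) (j%:R * c ^+ k) => x y.
  have beta0 : 0 <= beta.
    have z0 : 0 <= 4 / c ^+ k ^+ 2 * ((k * k)%:R / v%:R).
      by rewrite mulr_ge0 ?divr_ge0 ?exprn_ge0 // ltW.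
    by have := le_trans z0 v_ge; lra.
  move=> yb yb0 x0 xy; rewrite leNgt; apply/negP => bx.
  have y0 : 0 < y by rewrite -(pmulr_lgt0 _ (_ : 0 < beta)) // lt_neqAle beta0
    andbT; apply: contraTneq yb0 => <-; rewrite mulr0 ltxx.
  have : beta / 4 * y < x * y by rewrite ltr_pM2r.
  by lra.
move: eta_le v_ge gj; rewrite mulrDl mulrDr; move: (g _) => x.
have -> : 12 * 4 ^+ k / c ^+ k ^+ 2 * eta = 4 / c ^+ k ^+ 2 * (3 * 4 ^+ k *
  eta) by ring.
by move: (4 / _ * _) (4 / _ * _) => a d; lra.
Qed.

End Density.

(** * Choice of the constants *)

Lemma exists_nat_ge (R : archiRealFieldType) (x : R) : exists n : nat, forall
  m, n <= m -> (x <= m%:R)%R.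
Proof.
exists (Num.Def.archi_bound `|x|%R) => m nm.
apply: le_trans (ler_norm x) _; apply: ltW.
apply: lt_le_trans (Num.Theory.archi_boundP (normr_ge0 x)) _.
by rewrite ler_nat.
Qed.

(** The order of choice is [c = 1 / N], then [beta], then [eta] and the number [j] of phases, and
    last the bound on [v], which depends on [eta ^+ (2 ^ j)]. *)
Lemma disjoint_transversal_over (R : archiRealFieldType) (k Lam N : nat) : 0 <
  k -> 0 < N ->
  exists v0, forall (v : nat) (X S I : finType) (T : I -> S -> {set X}),
  v0 <= v -> #|S| = v ->
  (forall i s, #|T i s| = k) ->
  (forall i x, #|[set s | x \in T i s]| = k) ->
  (forall x y, x != y ->
    #|[set e : I * S | (x \in T e.1 e.2) && (y \in T e.1 e.2)]| <= Lam) ->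
  N * (k * #|I|) <= N.-1 * v ->
  exists sel : I -> S,
    forall i j, i != j -> [disjoint T i (sel i) & T j (sel j)].
Proof.
move=> k0 N0.
pose c : R := (N%:R^-1)%R.
have NR : (0 < N%:R :> R)%R by rewrite ltr0n.
have c0 : (0 < c)%R by rewrite invr_gt0.
have ck0 : (0 < c ^+ k)%R by rewrite exprn_gt0.
pose B : R := (4 * (k * k * (k + 2))%:R)%R.
have B0 : (0 < B)%R by rewrite mulr_gt0 // ltr0n !muln_gt0 k0 addn_gt0 k0.
pose beta : R := (c ^+ k / B)%R.
have beta0 : (0 < beta)%R by rewrite divr_gt0.
pose C : R := (2 + 12 * 4 ^+ k / c ^+ k ^+ 2)%R.
have C0 : (0 < C)%R by rewrite addr_gt0 ?divr_gt0 ?mulr_gt0 ?exprn_gt0.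
pose eta : R := Num.min 1%R (beta / 2 / C)%R.
have eta0 : (0 < eta)%R by rewrite lt_min ltr01 !divr_gt0.
have eta1 : (eta <= 1)%R by rewrite ge_min lexx.
have [j /(_ j (leqnn j)) j_ge] :=
  exists_nat_ge (4 * (4 ^ k.+1 + 1)%:R / (c ^+ k * beta))%R.
have [v1 v1P] := exists_nat_ge ((Lam + k + 1)%:R / eta ^+ (2 ^ j))%R.
have [v2 v2P] := exists_nat_ge (4 / c ^+ k ^+ 2 * (k * k)%:R / (beta / 4))%R.
exists ((4 ^ k.+1 + 1) + v1 + v2) => v X S I T vv0 Scard Tsize Tdeg Tcod Icard.
have v0 : 0 < v by apply: leq_trans vv0; rewrite addn1.
have vR : (0 < v%:R :> R)%R by rewrite ltr0n.
have Icard' : ((k * #|I|)%:R <= (1 - c) * v%:R)%R.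
  rewrite -(ler_pM2l NR) mulrA mulrBr mulr1 divff ?gt_eqF // -natrM.
  by rewrite -[1%R]/(1%:R)%R -natrB // -natrM ler_nat subn1.
apply: (transversal_exists k0 v0 Tsize Tdeg Tcod Scard c0 Icard'
          (eta := eta) (beta := beta) (j := j)).
- by rewrite eta1 ltW.
- by apply: leq_trans vv0; rewrite -addnA leq_addr.
- rewrite ler_pdivrMr // mulrC -ler_pdivrMr ?exprn_gt0 //; apply: v1P; lia.
- have cb0 : (0 < c ^+ k * beta)%R by exact: mulr_gt0.
  by move: j_ge; rewrite ler_pdivrMr // mulrA.
- have : (eta <= beta / 2 / C)%R by rewrite /eta ge_min lexx orbT.
  by rewrite ler_pdivlMr // mulrC.
- have b40 : (0 < beta / 4)%R by exact: divr_gt0.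
  have v2v : v2 <= v by lia.
  by have := v2P v v2v;
    rewrite ler_pdivrMr // mulrA ler_pdivrMr // [leRHS]mulrC.
- by rewrite -/B mulrC divfK // gt_eqF.
Qed.

Lemma disjoint_transversal (k Lam N : nat) : 0 < k -> 0 < N ->
  exists v0, forall (v : nat) (X S I : finType) (T : I -> S -> {set X}),
  v0 <= v -> #|S| = v ->
  (forall i s, #|T i s| = k) ->
  (forall i x, #|[set s | x \in T i s]| = k) ->
  (forall x y, x != y ->
    #|[set e : I * S | (x \in T e.1 e.2) && (y \in T e.1 e.2)]| <= Lam) ->
  N * (k * #|I|) <= N.-1 * v ->
  exists sel : I -> S,
    forall i j, i != j -> [disjoint T i (sel i) & T j (sel j)].
Proof. exact: (disjoint_transversal_over rat). Qed.

(** * Block orbits of cyclic designs *)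

Lemma card_bigcup_le (A B : finType) (P : pred A) (F : A -> {set B}) n :
  (forall a, P a -> #|F a| <= n) -> #|\bigcup_(a | P a) F a| <= #|P| * n.
Proof.
move=> Fn; rewrite -sum_nat_const.
elim/big_rec2: _ => [|a m C Pa IH]; first by rewrite cards0.
by rewrite (leq_trans (leq_card_setU _ _)) // leq_add ?Fn.
Qed.

Lemma sum_count_mem (A : finType) (P : pred A) (s : seq A) :
  \sum_(a | P a) count_mem a s = count P s.
Proof.
elim: s => [|b s IH] /=; first by rewrite big1_eq.
rewrite big_split /= IH; congr (_ + _).
rewrite big_mkcond (bigD1 b) //= eqxx big1 => [|a /negPf ab];
  first by case: (P b).
by rewrite eq_sym ab if_same.
Qed.

Lemma card_ord_lt n c : #|[set j : 'I_n | j < c]| <= c.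
Proof.
rewrite cardE -(size_map val) -[leqRHS](size_iota 0).
apply: uniq_leq_size; first by rewrite map_inj_uniq ?enum_uniq //;
  apply: val_inj.
by move=> _ /mapP[j + ->]; rewrite mem_enum inE mem_iota.
Qed.

Section CyclicDesign.
Variables (k lambda : nat) (X : finType) (Bs : seq {set X}) (sigma : {perm X}).
Hypothesis k_gt0 : 0 < k.
Hypothesis design : cyclic_BIBD #|X| k lambda Bs sigma.

Local Notation v := #|X|.
Local Notation shift n := (sigma ^+ n)%g.

(** * Shifts acting on points and blocks *)

Lemma block_size b : b \in Bs -> #|b| = k.
Proof. by case: design => -[_ H _] _ _; exact: H. Qed.

Lemma pair_count x y : x != y ->
  count (fun b : {set X} => (x \in b) && (y \in b)) Bs = lambda.
Proof. by case: design => -[_ _ H] _ _; exact: H. Qed.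

Lemma porbit_full x : porbit sigma x = [set: X].
Proof.
case: design => _ _ fc.
have : porbit sigma x \in porbits sigma by apply: imset_f.
by rewrite fc inE => /eqP.
Qed.

Lemma shift_transitive x y : exists2 n, n < v & shift n x = y.
Proof.
have : y \in porbit sigma x by rewrite porbit_full.
rewrite porbit_traject porbit_full cardsT => /trajectP[n nv ->].
by exists n; rewrite ?permX.
Qed.

Lemma shift_free x m n : m < v -> n < v -> shift m x = shift n x -> m = n.
Proof.
move=> mv nv; rewrite !permX => e; apply/eqP.
have := uniq_traject_porbit sigma x; rewrite porbit_full cardsT => U.
rewrite -(nth_uniq x _ _ U) ?size_traject // !nth_traject //; exact/eqP.
Qed.

Lemma shift_period x : shift v x = x.
Proof. by rewrite permX; have := iter_porbit sigma x;
  rewrite porbit_full cardsT. Qed.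

Lemma shift_fix_dvd x n : shift n x = x -> v %| n.
Proof.
move=> nx.
have v0 : 0 < v by apply/card_gt0P; exists x.
have Mx q : shift (q * v) x = x.
  by elim: q => [|q IH];
    rewrite ?expg0 ?perm1 // mulSn expgD permM shift_period.
have : shift (n %% v) x = shift 0 x.
  by rewrite expg0 perm1 -{2}nx {2}(divn_eq n v) expgD permM Mx.
by move/(shift_free (ltn_pmod _ v0) v0)/eqP.
Qed.

Lemma shift_imsetM m n (b : {set X}) : shift (m + n) @: b = shift n @: (shift m
  @: b).
Proof. by rewrite -imset_comp; apply: eq_imset => x;
  rewrite /= expgD permM. Qed.

Lemma count_shift (b : {set X}) n : count_mem (shift n @: b) Bs = count_mem b
  Bs.
Proof.
elim: n => [|n IH].
  by rewrite expg0; congr (count_mem _ _); rewrite -[RHS]imset_id;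
    apply: eq_imset => x; rewrite perm1.
rewrite -IH -addn1 shift_imsetM expg1; move: (shift n @: b) => {IH}b.
case: design => _ /seq.permP/(_ (pred1 (sigma @: b))) <- _.
rewrite count_map; apply: eq_count => b' /=; apply/eqP/eqP => [|->//].
exact/imset_inj/perm_inj.
Qed.

Lemma mem_block_orbit (b : {set X}) n : shift n @: b \in block_orbit sigma b.
Proof.
apply/orbitP; exists (shift n); first exact: mem_cycle.
by apply: eq_imset.
Qed.

Lemma block_orbit_shift (b : {set X}) n : block_orbit sigma (shift n @: b) =
  block_orbit sigma b.
Proof. by apply/orbit_eqP/mem_block_orbit. Qed.

(** Copy numbers are below a multiplicity, hence below [size Bs]; this bound makes the indices a
    finite type. *)
Definition orbit_index_pred (o : {set {set X}} * 'I_(size Bs)) : bool :=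
  [exists b, (o.1 == block_orbit sigma b) && (o.2 < count_mem b Bs)].

Definition orbit_index := {o | orbit_index_pred o}.

Definition rep (i : orbit_index) : {set X} :=
  odflt set0 [pick b | ((val i).1 == block_orbit sigma b) &&
                       ((val i).2 < count_mem b Bs)].

Lemma repP i : (val i).1 = block_orbit sigma (rep i) /\ (val i).2 < count_mem
  (rep i) Bs.
Proof.
rewrite /rep; case: pickP => [b /andP[/eqP]//|H].
by have /existsP[b] := valP i; rewrite H.
Qed.

(** All [v] shifts are kept, so a short orbit lists its blocks repeatedly and every orbit has the
    same degrees. *)
Definition translate (i : orbit_index) (s : 'I_v) : {set X} := shift s @: rep i.

Lemma rep_size i : #|rep i| = k.
Proof.
apply: block_size; rewrite -has_pred1 has_count.
by case: (repP i) => _; apply: leq_ltn_trans.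
Qed.

Lemma translate_size i s : #|translate i s| = k.
Proof. by rewrite card_imset ?rep_size //; apply: perm_inj. Qed.

(** Moving [x] back by [s] is a bijection from these shifts onto the representative. *)
Lemma translate_deg i x : #|[set s | x \in translate i s]| = k.
Proof.
rewrite -(card_in_imset (f := fun s : 'I_v => ((shift s)^-1)%g x)) /=;
  last first.
  move=> s s' _ _ /= e; apply: val_inj.
  apply: (@shift_free (((shift s')^-1)%g x));
    [exact: ltn_ord | exact: ltn_ord |].
  by rewrite permKV -e permKV.
rewrite -(rep_size i); congr #|pred_of_set _|; apply/setP => p;
  apply/imsetP/idP.
  by case=> s; rewrite inE => /imsetP[q qr ->] ->; rewrite permK.
move=> pr; have [n nv e] := shift_transitive p x.
by exists (Ordinal nv); rewrite ?inE /= -?e ?permK // imset_f.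
Qed.

(** * Codegrees and the number of orbits *)

Definition copies (P : pred {set X}) : {set {set X} * 'I_(size Bs)} :=
  [set p : {set X} * 'I_(size Bs) | P p.1 && (p.2 < count_mem p.1 Bs)].

Lemma card_copies P : #|copies P| <= count P Bs.
Proof.
rewrite -sum1_card -sum_count_mem.
rewrite (eq_bigl (fun p : {set X} * 'I_(size Bs) => P p.1 && (p.2 < count_mem
  p.1 Bs)));
  last by move=> p; rewrite inE.
rewrite -(pair_big_dep P (fun b (j : 'I_(size Bs)) => j < count_mem b Bs) (fun
  _ _ => 1)) /=.
apply: leq_sum => b _; apply: leq_trans (card_ord_lt (size Bs) _).
by rewrite -sum1_card leq_eqVlt; apply/orP; left; apply/eqP;
  apply: eq_bigl => j; rewrite inE.
Qed.

Definition copy_of (e : orbit_index * 'I_v) : {set X} * 'I_(size Bs) :=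
  (translate e.1 e.2, (val e.1).2).

Lemma copy_of_index e e' : copy_of e = copy_of e' -> e.1 = e'.1.
Proof.
case=> eT ej; apply: val_inj;
  rewrite [LHS]surjective_pairing [RHS]surjective_pairing.
congr pair; last exact: ej.
have [-> _] := repP e.1; have [-> _] := repP e'.1.
by rewrite -(block_orbit_shift _ e.2) -[RHS](block_orbit_shift _ e'.2)
  -/(translate _ _) eT.
Qed.

Lemma mem_copies (P : pred {set X}) e :
  P (translate e.1 e.2) -> copy_of e \in copies P.
Proof. by move=> Pe; rewrite inE /= Pe count_shift; case: (repP e.1). Qed.

(* A copy of a block comes from at most [k] pairs (orbit, shift), since the
   shift is determined by the image of a fixed point of the representative. *)
Lemma translate_codeg x y : x != y ->
  #|[set e : orbit_index * 'I_v |
      (x \in translate e.1 e.2) && (y \in translate e.1 e.2)]| <= lambda * k.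
Proof.
move=> ne; set E := [set _ | _].
pose p i := odflt x [pick z in rep i].
have pP i : p i \in rep i.
  rewrite /p; case: pickP => //= r0; have := rep_size i.
  by rewrite (eq_card0 r0) => k0; move: k_gt0; rewrite -k0.
pose F e := (copy_of e, shift e.2 (p e.1)).
have Finj : injective F.
  move=> [i s] [i' s'] [eT ej es].
  have ii' : i = i' by apply: (@copy_of_index (i, s) (i', s'));
    rewrite /copy_of eT ej.
  subst i'; congr pair; apply: val_inj.
  exact: shift_free (ltn_ord s) (ltn_ord s') es.
rewrite -(card_imset _ Finj) -(pair_count ne).
pose P := fun b : {set X} => (x \in b) && (y \in b).
apply: (@leq_trans #|\bigcup_(q in copies P) (pair q @: q.1)|).
  apply: subset_leq_card; apply/subsetP => _ /imsetP[e eE ->].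
  apply/bigcupP; exists (copy_of e); first by apply: mem_copies;
    rewrite inE in eE.
  by rewrite /F imset_f //= imset_f.
apply: (@leq_trans (#|copies P| * k));
  last by rewrite leq_mul2r card_copies orbT.
apply: card_bigcup_le => q; rewrite inE => /andP[_ qc].
rewrite card_imset; last by move=> ? ? [].
rewrite block_size // -has_pred1 has_count.
exact: leq_ltn_trans qc.
Qed.

(** The classical replication identity [r * (k - 1) = lambda * (v - 1)], by double counting the
    pairs of a block through [x] and another point of it. *)
Lemma point_count x : count (fun b : {set X} => x \in b) Bs * k.-1 = lambda *
  v.-1.
Proof.
transitivity (\sum_(y | y != x) count (fun b : {set X} => (x \in b) && (y \in
  b)) Bs).
  transitivity (\sum_(y | y != x) \sum_(b <- Bs | x \in b) (y \in b : nat)).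
    rewrite exchange_big /= -sum1_count big_distrl /= -big_filter
      -[RHS]big_filter.
    apply: eq_big_seq => b; rewrite mem_filter => /andP[xb bB].
    rewrite mul1n -(block_size bB) (cardsD1 x b) xb /=.
    rewrite -sum1_card big_mkcond [RHS]big_mkcond /=; apply: eq_bigr => y _.
    by rewrite !inE; case: (y != x); case: (y \in b).
  apply: eq_bigr => y _; rewrite -sum1_count big_mkcond [RHS]big_mkcond /=.
  by apply: eq_bigr => b _; case: (x \in b); case: (y \in b).
rewrite (eq_bigr (fun=> lambda)) => [|y yx];
  last by rewrite pair_count // eq_sym.
by rewrite sum_nat_const mulnC; congr (_ * _); rewrite -(cardC1 x).
Qed.

Definition full_orbits : {set orbit_index} := [set i | injectiveb (translate
  i)].

(** Each full orbit has [k] distinct translates through [x], and these are distinct copies of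
    blocks. *)
Lemma card_full_orbits x : k * #|full_orbits| <= count (fun b : {set X} => x
  \in b) Bs.
Proof.
pose E := [set e : orbit_index * 'I_v | (e.1 \in full_orbits) && (x \in
  translate e.1 e.2)].
have -> : k * #|full_orbits| = #|E|.
  rewrite mulnC -sum_nat_const -sum1_card.
  rewrite (eq_bigl (fun e => (e.1 \in full_orbits) && (x \in translate e.1
    e.2))) => [|e]; last by rewrite inE.
  rewrite -(pair_big_dep (mem full_orbits) (fun i s => x \in translate i s)
    (fun _ _ => 1)) /=.
  apply: eq_bigr => i _; rewrite -(translate_deg i x) -sum1_card.
  by apply: eq_bigl => s; rewrite inE.
rewrite -(card_in_imset (f := copy_of)); last first.
  move=> [i s] [i' s']; rewrite inE => /andP[/= iJ _] _ e.
  have /= ii' := copy_of_index e; subst i'; case: e => e.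
  by move: iJ; rewrite inE => /injectiveP/(_ s s' e) ->.
apply: leq_trans (card_copies _); apply: subset_leq_card.
apply/subsetP => _ /imsetP[e + ->]; rewrite inE => /andP[_ xe].
exact: mem_copies.
Qed.

(* A nontrivial shift [d] fixing a block has order at most [k], which leaves
   boundedly many possibilities for [d]; the block contains [x] and its
   image under [d], so the codegree bounds the number of orbits for each [d]. *)
Lemma card_short_orbits : #|~: full_orbits| <= k.+1 * k.+1 * (lambda * k).
Proof.
have [->|/set0Pn[i0 _]] := eqVneq (~: full_orbits) set0;
  first by rewrite cards0.
have [x _] : exists x, x \in rep i0 by apply/card_gt0P; rewrite rep_size.
(* A shift [d] under which [x] has orbit length [e] satisfies [d * e = v * j]; here [q] is the pair
   [(e, j)]. For [q.1 = 0] the quotient is 0, and [x != y q] excludes it. *)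
pose y (q : 'I_k.+1 * 'I_k.+1) := shift (v * q.2 %/ q.1) x.
pose O q := [set e.1 | e in [set e : orbit_index * 'I_v |
      (x \in translate e.1 e.2) && (y q \in translate e.1 e.2)]].
apply: (@leq_trans #|\bigcup_(q | x != y q) O q|); last first.
  apply: (@leq_trans (#|[pred q | x != y q]| * (lambda * k))); last first.
    rewrite leq_mul2r; apply/orP; right; apply: leq_trans (max_card _) _.
    by rewrite card_prod card_ord.
  apply: card_bigcup_le => q xy; apply: leq_trans (leq_imset_card _ _) _.
  exact: translate_codeg.
apply: subset_leq_card; apply/subsetP => i;
  rewrite !inE => /injectivePn[s [s' ss' eT]].
have [d [d0 dv dfix]] : exists d, [/\ 0 < d, d < v & shift d @: rep i = rep i].
  have aux (a b : 'I_v) : a < b -> translate i a = translate i b ->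
      exists d, [/\ 0 < d, d < v & shift d @: rep i = rep i].
    move=> ab; rewrite /translate => e; exists (b - a); split.
    - by rewrite subn_gt0.
    - by apply: leq_ltn_trans (leq_subr _ _) (ltn_ord b).
    - by apply: (imset_inj (@perm_inj _ (shift a)));
      rewrite -shift_imsetM subnK // ltnW.
  have [lt|lt|e] := ltngtP s s'.
  - exact: aux lt eT.
  - exact: aux lt (esym eT).
  - by rewrite (val_inj e) eqxx in ss'.
have : 0 < #|[set t | x \in translate i t]| by rewrite translate_deg.
case/card_gt0P=> t; rewrite inE => xt.
have tfix : shift d @: translate i t = translate i t.
  by rewrite /translate -shift_imsetM addnC shift_imsetM dfix.
pose e := #|porbit (shift d) x|.
have orb_sub : porbit (shift d) x \subset translate i t.
  apply/subsetP => _ /porbitP[n ->]; elim: n => [|n IH];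
    first by rewrite expg0 perm1.
  by rewrite expgSr permM -tfix imset_f.
have ek : e <= k by rewrite -(translate_size i t) subset_leq_card.
have e0 : 0 < e by apply/card_gt0P; exists x; apply: porbit_id.
have /dvdnP[j de] : v %| d * e.
  by apply: (@shift_fix_dvd x); rewrite expgM permX iter_porbit.
have v0 : 0 < v by apply: leq_ltn_trans dv.
have je : j < e.
  by rewrite -(ltn_pmul2r v0) -de [ltnRHS]mulnC ltn_pmul2r.
have ek' : e < k.+1 by [].
have jk' : j < k.+1 by apply: leq_trans je _; apply: leqW.
apply/bigcupP; exists (Ordinal ek', Ordinal jk').
  rewrite /y /= mulnC -de mulnK //; apply/eqP => xd.
  have /(dvdn_leq d0) := shift_fix_dvd (esym xd).
  by rewrite leqNgt dv.
apply/imsetP; exists (i, t) => //; rewrite inE /= xt /y /= mulnC -de mulnK //.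
by rewrite -tfix imset_f.
Qed.

Lemma card_orbits : 0 < v ->
  k.-1 * (k * #|{: orbit_index}|) <= lambda * v.-1 + k.-1 * (k * (k.+1 * k.+1 *
    (lambda * k))).
Proof.
case/card_gt0P=> x _; have := card_short_orbits.
move: (k.+1 * _ * _) => A short;
  rewrite -(cardsC full_orbits) !mulnDr leq_add //.
  by rewrite -(point_count x) [leqRHS]mulnC leq_mul2l card_full_orbits orbT.
by rewrite !leq_mul2l short !orbT.
Qed.

End CyclicDesign.

(** As [l <= k - 2] and [C <= v / 2], [Q] is at most [(1 - 1 / (2 * (k - 1))) * v], which is within
    the required [(1 - 1 / (2 * k)) * v]. *)
Lemma density_bound k l v C Q : l + 2 <= k -> 2 * C <= v ->
  k.-1 * Q <= l * v.-1 + C -> 2 * k * Q <= (2 * k).-1 * v.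
Proof.
case: k => [|[|k]]; rewrite ?addn2 //= !ltnS => lk Cv H.
have lv : l * v.-1 <= k * v by apply: leq_mul => //; apply: leq_pred.
rewrite -(leq_pmul2l (ltn0Sn k)).
by nia.
Qed.

Theorem theorem1p10 (k lambda : nat) (hk : 0 < k) (hlambda : 0 < lambda)
    (hkl : lambda + 2 <= k) :
  exists v0 : nat,
    forall (v : nat) (X : finType) (Bs : seq {set X}) (sigma : {perm X}),
      cyclic_BIBD v k lambda Bs sigma -> v0 <= v ->
      exists c : {set {set X}} * nat -> {set X},
        disjoint_representatives Bs sigma c.
Proof.
have N0 : 0 < 2 * k by rewrite muln_gt0.
have [v0 core] := disjoint_transversal (lambda * k) hk N0.
pose C := k.-1 * (k * (k.+1 * k.+1 * (lambda * k))).
(* [2 * C] is for [density_bound], and the successor makes [X] nonempty. *)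
exists (v0 + (2 * C).+1) => v X Bs sigma design v_ge.
have vX : #|X| = v by case: design => -[].
have X0 : 0 < #|X| by rewrite vX; lia.
rewrite -{v}vX in design v_ge.
have [||sel selD] := core #|X| X 'I_#|X| (orbit_index Bs sigma) (@translate X
  Bs sigma) _ (card_ord _)
  (translate_size design) (translate_deg design) (translate_codeg hk design).
- by lia.
- apply: (density_bound hkl _ (card_orbits hk design X0)).
  by rewrite -/C; lia.
(* The value [set0] is taken only on pairs that are not block orbits. *)
pose c (o : {set {set X}} * nat) :=
  if insub o.2 is Some j then
    if insub (o.1, j) is Some i then translate i (sel i) else set0
  else set0.
have cP o : is_block_orbit Bs sigma o ->
    exists2 i : orbit_index Bs sigma, (o.1 = (val i).1) /\ (o.2 = (val i).2 :>
      nat)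
      & c o = translate i (sel i).
  case: o => O j [b [/= Ob jb]]; rewrite /c /=.
  have js : j < size Bs by apply: leq_trans jb _; apply: count_size.
  rewrite insubT /=.
  have op : orbit_index_pred sigma (O, Ordinal js).
    by apply/existsP; exists b; rewrite /= Ob eqxx.
  by rewrite insubT; exists (Sub (O, Ordinal js) op); rewrite ?SubK.
exists c; split=> [o /cP[i [-> _] ->]|o o' /cP[i [o1 o2] ->] /cP[i' [o1' o2']
  ->] ne].
  by have [-> _] := repP i; apply: mem_block_orbit.
apply: selD; apply: contra_not_neq ne => ii'; subst i'.
by rewrite [o]surjective_pairing [o']surjective_pairing o1 o2 o1' o2'.
Qed.
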